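(* Given a function $x\in C^1[a,b]$, we have $${^C\mathcal{D}_{a+}^{\alpha,\rho}}\,\mathcal{I}_{a+}^{\alpha,\rho} x(t)=x(t) \quad \text{and} \quad {^C\mathcal{D}_{b-}^{\alpha,\rho}}\,\mathcal{I}_{b-}^{\alpha,\rho} x(t)=x(t).$$
   Context: Let $0<a<b<\infty$ be two reals, $\rho>0$, $\alpha>0$, and let $n\in\mathbb{N}$ be such that $\alpha\in(n-1,n)$. For $m\in\mathbb{N}$, $C^m[a,b]$ is the set of functions $x:[a,b]\to\mathbb{R}$ such that $x^{(m)}$ exists and is continuous on $[a,b]$. For an integrable function $x:[a,b]\to\mathbb{R}$, the left-sided and right-sided Katugampola fractional integrals of order $\alpha>0$ and parameter $\rho>0$ are $$\mathcal{I}_{a+}^{\alpha,\rho}x(t)=\frac{\rho^{1-\alpha}}{\Gamma(\alpha)}\int_a^t \tau^{\rho-1}(t^\rho-\tau^\rho)^{\alpha-1}x(\tau)\, d\tau,\qquad \mathcal{I}_{b-}^{\alpha,\rho}x(t)=\frac{\rho^{1-\alpha}}{\Gamma(\alpha)}\int_t^b \tau^{\rho-1}(\tau^\rho-t^\rho)^{\alpha-1}x(\tau)\, d\tau,$$ where $\Gamma$ is the Gamma function. For a function $y:[a,b]\to\mathbb{R}$ of class $C^n$, the left-sided and right-sided Caputo-Katugampola fractional derivatives of order $\alpha$ and parameter $\rho$ are defined by $${^C\mathcal{D}_{a+}^{\alpha,\rho}}y(t)=\mathcal{I}_{a+}^{n-\alpha,\rho}\left(t^{1-\rho}\frac{d}{dt}\right)^n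 y(t)=\frac{\rho^{1-n+\alpha}}{\Gamma(n-\alpha)}\int_a^t \tau^{\rho-1}(t^\rho-\tau^\rho)^{n-\alpha-1}\left(\tau^{1-\rho}\frac{d}{d\tau}\right)^n y(\tau)\, d\tau,$$ $${^C\mathcal{D}_{b-}^{\alpha,\rho}}y(t)=\mathcal{I}_{b-}^{n-\alpha,\rho}\left(-t^{1-\rho}\frac{d}{dt}\right)^n y(t)=\frac{\rho^{1-n+\alpha}}{\Gamma(n-\alpha)}\int_t^b \tau^{\rho-1}(\tau^\rho-t^\rho)^{n-\alpha-1}\left(-\tau^{1-\rho}\frac{d}{d\tau}\right)^n y(\tau)\, d\tau.$$
   Formalization: The identities are stated for t in (a,b] (left) and [a,b) (right), since at the base point the formula gives 0, not x(t); the Caputo derivative is read as its integral formula with derivatives on the open interval, as the fractional integral of x need not be C^n at the base point. *)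

(* Defs.v *)
From HB Require Import structures.
From mathcomp Require Import all_boot all_order all_algebra.
From mathcomp Require Import all_classical all_reals all_analysis.
Set Implicit Arguments.
Unset Strict Implicit.
Unset Printing Implicit Defensive.
Import Order.TTheory GRing.Theory Num.Theory.
Import numFieldNormedType.Exports.
Local Open Scope classical_set_scope.
Local Open Scope ring_scope.

(* A function on [a, b] is represented by a total function R -> R; only its
   values on [a, b] are ever used. *)

(* The derivative is relative to [a, b], hence one-sided at a and at b. *)
Definition is_derivative_on (R : realType) (a b : R) (x dx : R -> R) : Prop :=
  forall t : R, a <= t <= b ->
    (fun s : R => (x s - x t) / (s - t)) @ within `[a, b] t^' --> dx t.

Fixpoint class_C (R : realType) (m : nat) (a b : R) (x : R -> R) : Prop :=
  match m with
  | 0%N => {within `[a, b], continuous x}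
  | k.+1 => exists2 dx : R -> R, is_derivative_on a b x dx & class_C k a b dx
  end.

Definition Gamma (R : realType) (z : R) : R :=
  \int[lebesgue_measure]_(s in `]0, +oo[) (s `^ (z - 1) * expR (- s)).

(* The singular factor is evaluated at base 0 only at tau = t, a null set. *)
Definition left_integrand (R : realType) (alpha rho : R) (x : R -> R)
    (t tau : R) : R :=
  tau `^ (rho - 1) * (t `^ rho - tau `^ rho) `^ (alpha - 1) * x tau.

Definition right_integrand (R : realType) (alpha rho : R) (x : R -> R)
    (t tau : R) : R :=
  tau `^ (rho - 1) * (tau `^ rho - t `^ rho) `^ (alpha - 1) * x tau.

Definition left_integral (R : realType) (a alpha rho : R) (x : R -> R)
    (t : R) : R :=
  rho `^ (1 - alpha) / Gamma alpha *
  \int[lebesgue_measure]_(tau in `[a, t]) left_integrand alpha rho x t tau.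

Definition right_integral (R : realType) (b alpha rho : R) (x : R -> R)
    (t : R) : R :=
  rho `^ (1 - alpha) / Gamma alpha *
  \int[lebesgue_measure]_(tau in `[t, b]) right_integrand alpha rho x t tau.

(* t^(1 - rho) d/dt.  The derivative is two-sided; for a function on [a, b] it
   is meaningful on ]a, b[, which suffices under the integrals below. *)
Definition left_op (R : realType) (rho : R) (y : R -> R) : R -> R :=
  fun t => t `^ (1 - rho) * derive1 y t.

Definition right_op (R : realType) (rho : R) (y : R -> R) : R -> R :=
  fun t => - (t `^ (1 - rho)) * derive1 y t.

(* n is the integer with n - 1 < alpha < n. *)
Definition left_caputo (R : realType) (n : nat) (a alpha rho : R)
    (y : R -> R) : R -> R :=
  left_integral a (n%:R - alpha) rho (iter n (left_op rho) y).

Definition right_caputo (R : realType) (n : nat) (b alpha rho : R)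
    (y : R -> R) : R -> R :=
  right_integral b (n%:R - alpha) rho (iter n (right_op rho) y).

(* derive1 and the integral are total functions, with default values.  The
   next two predicates say that no default value is involved: the iterated
   derivatives exist on the open interval of integration, and the integral
   converges absolutely.  A fractional integral of order alpha need not be of
   class C^n up to the base point of the integral, where its n-th derivative
   may blow up, so this is the sense in which the Caputo formula applies to
   it. *)
Definition left_caputo_defined (R : realType) (n : nat) (a alpha rho : R)
    (y : R -> R) (t : R) : Prop :=
  (forall (k : nat) (s : R), (k < n)%N -> a < s < t ->
     derivable (iter k (left_op rho) y) s 1) /\
  lebesgue_measure.-integrable `[a, t]
    (EFin \o left_integrand (n%:R - alpha) rho (iter n (left_op rho) y) t).

Definition right_caputo_defined (R : realType) (n : nat) (b alpha rho : R)
    (y : R -> R) (t : R) : Prop :=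
  (forall (k : nat) (s : R), (k < n)%N -> t < s < b ->
     derivable (iter k (right_op rho) y) s 1) /\
  lebesgue_measure.-integrable `[t, b]
    (EFin \o right_integrand (n%:R - alpha) rho (iter n (right_op rho) y) t).

(* Main.v *)
Require Import Defs.
From HB Require Import structures.
From mathcomp Require Import all_boot all_order all_algebra.
From mathcomp Require Import all_classical all_reals all_analysis.
From mathcomp Require Import measurable_realfun ring lra.
Import Order.TTheory GRing.Theory Num.Theory.
Import numFieldNormedType.Exports.
Local Open Scope classical_set_scope.
Local Open Scope ring_scope.

Set Implicit Arguments.
Unset Strict Implicit.
Unset Printing Implicit Defensive.

(** The Caputo-Katugampola derivative inverts the Katugampola integral because,
    in the variable [v = t ^ rho] (left side) or [v = - t ^ rho] (right side),
    all the operators of the statement become convolutions with the Riesz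
    kernels [kappa_p(s) = s ^ (p - 1) / Gamma(p)], [s > 0], or the derivative
    [d / dv], up to powers of [rho] that cancel in the end.

    Write [A] for the image of the base point, [c] for the value of [x] there
    and [h] for the derivative of [x] in the new variable.  Then [x] is the
    distribution function of the signed measure [m = c delta_A + h(u) du], that
    is [x = kappa_1 * m], as [kappa_1] is the indicator of [s > 0].  The proof
    consists in following the scale of functions [E_q = kappa_q * m], [q > 0]
    (primitive_scale):
    - [E_1 = x] beyond [A] (primitive_scale1);
    - [kappa_p * E_q = E_(p + q)] (primitive_scale_semigroup), by Fubini and the
      identity [kappa_p * kappa_q = kappa_(p + q)] (riesz_kernel_conv), which is
      Euler's formula for the Beta function;
    - [E_(1 + q)] is differentiable in the interior, with derivative [E_q]
      (derive_primitive_scale): it is the primitive of [E_q], by the previous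
      point with [p = 1], and [E_q] is continuous there even if [q < 1].
    Hence the fractional integral of order [alpha] of [x] is [E_(1 + alpha)],
    its [n]-th derivative is [E_(1 + alpha - n)], where
    [0 < 1 + alpha - n < 1], and the last fractional integral, of order
    [n - alpha], gives back [E_1 = x].  The function [E_(1 + alpha - n)]
    contains the term [c kappa_(1 + alpha - n)(v - A)], which is unbounded near
    [A] but integrable; the other term comes from the density [h], which is
    bounded, and continuous inside the interval, because [x] is of class C^1.

    The integrands are singular at one or both ends of the interval of
    integration, so the substitution [v = t ^ rho] is needed for arbitrary
    measurable functions.  It is obtained from the uniqueness of the Lebesgue
    measure: it suffices that the substitution has the right effect on
    intervals (change_of_variables). *)

(** * Change of variables in Lebesgue integrals *)

Section density.
Local Open Scope ereal_scope.
Context d (T : measurableType d) (R : realType).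
Context (mu : {measure set T -> \bar R}).
Context (w : T -> R) (mw : measurable_fun setT w) (w0 : forall t, (0 <= w t)%R).

Definition density (X : set T) : \bar R := \int[mu]_(t in X) (w t)%:E.

Let density0 : density set0 = 0.
Proof. by rewrite /density integral_set0. Qed.

Let density_ge0 X : 0 <= density X.
Proof. by apply: integral_ge0 => t _; rewrite lee_fin. Qed.

Let density_sigma_additive : semi_sigma_additive density.
Proof.
move=> /= F mF tF mUF; rewrite /density; apply: cvg_toP.
  apply: ereal_nondecreasing_is_cvgn => m n mn.
  apply: lee_sum_nneg_natr => // k _ _; apply: integral_ge0 => /= x Fkx.
  by rewrite lee_fin.
rewrite ge0_integral_bigcup//=.
- exact/measurable_funTS/measurable_EFinP.
- by move=> x _; rewrite lee_fin.
Qed.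

HB.instance Definition _ := isMeasure.Build _ _ _
  density density0 density_ge0 density_sigma_additive.

(** A named structure, so that [density] can be pushed forward. *)
Definition density_measure : {measure set T -> \bar R} := density.

Import HBNNSimple.

Lemma ge0_integral_density (f : T -> \bar R) : measurable_fun setT f ->
  (forall t, 0 <= f t) ->
  \int[density_measure]_t f t = \int[mu]_t (f t * (w t)%:E).
Proof.
move=> mf f0.
pose f_ := nnsfun_approx measurableT mf.
have mfw n : measurable_fun setT (fun t => (f_ n t)%:E * (w t)%:E).
  by under eq_fun do rewrite -EFinM; exact/measurable_EFinP/measurable_funM.
transitivity (limn (fun n => \int[density_measure]_t (f_ n t)%:E)).
  rewrite -monotone_convergence//.
  - apply: eq_integral => y _; apply/esym/cvg_lim => //.
    by apply: cvg_nnsfun_approx.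
  - by move=> n; exact/measurable_EFinP/measurable_funP.
  - by move=> n y _; rewrite lee_fin.
  - by move=> y _ m n mn; rewrite lee_fin; exact/lefP/nd_nnsfun_approx.
transitivity (limn (fun n => \int[mu]_t ((f_ n t)%:E * (w t)%:E))); last first.
  rewrite -monotone_convergence//.
  - apply: eq_integral => y _; apply/cvg_lim => //.
    apply: cvgeZr => //; exact: cvg_nnsfun_approx.
  - by move=> n y _; rewrite -EFinM lee_fin mulr_ge0.
  - move=> y _ m n mn; apply: lee_wpmul2r; first by rewrite lee_fin.
    by rewrite lee_fin; exact/lefP/nd_nnsfun_approx.
congr (limn _); apply/funext => n.
have mfn r : measurable (f_ n @^-1` [set r]) by [].
transitivity (\sum_(k \in range (f_ n))
    \int[density_measure]_t (k * \1_(f_ n @^-1` [set k]) t)%:E).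
  under eq_integral do rewrite fimfunE -fsumEFin//.
  rewrite ge0_integral_fsum//.
  - by move=> y; exact/measurable_EFinP/measurable_funM.
  - by move=> y x _; rewrite nnfun_muleindic_ge0.
transitivity (\sum_(k \in range (f_ n))
    \int[mu]_t ((k * \1_(f_ n @^-1` [set k]) t)%:E * (w t)%:E)); last first.
  rewrite -ge0_integral_fsum//.
  - apply: eq_integral => t _; rewrite -ge0_mule_fsuml; last first.
      by move=> i; rewrite nnfun_muleindic_ge0.
    by rewrite fsumEFin// -fimfunE.
  - move=> y; under eq_fun do rewrite -EFinM.
    by apply/measurable_EFinP/measurable_funM => //; exact: measurable_funM.
  - by move=> y x _; rewrite mule_ge0 ?lee_fin// -lee_fin nnfun_muleindic_ge0.
apply: eq_fsbigr => r _.
rewrite integralZl_indic_nnsfun// integral_indic//= setIT.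
have [r0|r0] := ltP r 0%R.
  rewrite preimage_nnfun0//= measure0 mule0 integral0_eq// => t _.
  by rewrite indicE in_set0 mulr0 mul0e.
under eq_integral do rewrite EFinM -muleA.
rewrite ge0_integralZl_EFin//; last 2 first.
- by move=> t _; rewrite mule_ge0// lee_fin.
- under eq_fun do rewrite -EFinM.
  by apply/measurable_EFinP/measurable_funM.
congr (_ * _); rewrite [LHS]/density [LHS]integral_mkcond.
apply: eq_integral => t _; rewrite patchE indicE.
by case: ifPn; rewrite ?mul1e ?mul0e.
Qed.

End density.

Section change_of_variables_measure.
Local Open Scope ereal_scope.
Context d1 d2 (X : measurableType d1) (Y : measurableType d2) (R : realType).
Context (mu : {measure set X -> \bar R}) (nu : {measure set Y -> \bar R}).
Context (phi : X -> Y) (mphi : measurable_fun setT phi).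
Context (w : X -> R) (mw : measurable_fun setT w) (w0 : forall t, (0 <= w t)%R).

Let image_measure : {measure set Y -> \bar R} :=
  measure_function_pushforward__canonical__measure_function_Measure
    (density_measure mu mw w0) mphi.

Lemma integral_image_density :
  (forall A, measurable A -> nu A = \int[mu]_(x in phi @^-1` A) (w x)%:E) ->
  forall f : Y -> \bar R, measurable_fun setT f -> (forall y, 0 <= f y) ->
  \int[nu]_y f y = \int[mu]_x (f (phi x) * (w x)%:E).
Proof.
move=> numu f mf f0.
have mfphi : measurable_fun setT (f \o phi) by exact: (measurableT_comp mf mphi).
have fphi0 t : 0 <= (f \o phi) t by exact: f0.
rewrite -(ge0_integral_density mu mw w0 mfphi fphi0).
rewrite -[in RHS](preimage_setT phi) -ge0_integral_pushforward//.
by apply: (eq_measure_integral image_measure) => A mA _; exact: numu.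
Qed.

End change_of_variables_measure.

Section change_of_variables.
Context {R : realType}.
Notation mu := (@lebesgue_measure R).
Local Open Scope ereal_scope.
Context (phi w : measurableTypeR R -> measurableTypeR R).
Hypotheses (mphi : measurable_fun setT phi) (mw : measurable_fun setT w).
Hypothesis w0 : forall t, (0 <= w t)%R.
Hypothesis phiw : forall c d : R, (c < d)%R ->
  \int[mu]_(t in phi @^-1` `]c, d]) (w t)%:E = (d - c)%:E.

(** The image under [phi] of the measure with density [w] agrees with the
    Lebesgue measure on half-open intervals, hence on all Borel sets. *)
Lemma ge0_change_of_variables (f : R -> \bar R) : measurable_fun setT f ->
  (forall t, 0 <= f t) ->
  \int[mu]_t f t = \int[mu]_t (f (phi t) * (w t)%:E).
Proof.
move=> mf f0.
refine (integral_image_density (mu := mu) (nu := mu) mphi mw w0 _ mf f0).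
pose nu := measure_function_pushforward__canonical__measure_function_Measure
  (density_measure mu mw w0) mphi.
apply: (lebesgue_measure_unique (mu := nu)) => _ [[a b]] _ <-.
rewrite /= /pushforward /density /= lebesgue_measure_itv/= lte_fin.
have [ab|ba] := ltP a b; first by rewrite phiw ?EFinB.
by rewrite set_itv_ge ?bnd_simp -?leNgt// preimage_set0 integral_set0.
Qed.

(** Both sides are by definition the difference of the integrals of a positive
    and a negative part, which agree by [ge0_change_of_variables]; this holds
    for functions that are not integrable too, with the same conventional value
    on both sides. *)
Lemma change_of_variables (f : R -> R) : measurable_fun setT f ->
  \int[mu]_t (f t)%:E = \int[mu]_t (f (phi t) * w t)%:E.
Proof.
move=> mf; rewrite [LHS]integralE [RHS]integralE; congr (_ - _).
  rewrite ge0_change_of_variables//.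
    apply: eq_integral => t _; rewrite !funeposE -!EFin_max -EFinM.
    by rewrite maxr_pMl// mul0r.
  exact/measurable_funepos/measurable_EFinP.
rewrite ge0_change_of_variables//.
  apply: eq_integral => t _; rewrite !funenegE -!EFinN -!EFin_max -EFinM.
  by rewrite maxr_pMl// mul0r mulNr.
exact/measurable_funeneg/measurable_EFinP.
Qed.

End change_of_variables.

Section substitutions.
Context {R : realType}.
Notation mu := (@lebesgue_measure R).
Local Open Scope ereal_scope.

Lemma change_of_variables_opp (f : R -> R) : measurable_fun setT f ->
  \int[mu]_t (f t)%:E = \int[mu]_t (f (- t)%R)%:E.
Proof.
move=> mf; rewrite (@change_of_variables R (fun t => - t)%R (cst 1%R))//.
- by apply: eq_integral => t _; rewrite mulr1.
- exact: measurable_funN.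
- move=> p q pq.
  rewrite (_ : _ @^-1` _ = `[(- q)%R, (- p)%R[%classic); last first.
    by apply/seteqP; split => t /=; rewrite !in_itv/=; lra.
  rewrite (integral_cst mu _ 1%:E)//= lebesgue_measure_itv/= lte_fin.
  by rewrite ltrN2 pq mul1e -EFinB opprK addrC.
Qed.

Let affine_itv (c k p q : R) : (0 < k)%R -> (p < q)%R ->
  \int[mu]_(t in (fun t => c + k * t)%R @^-1` `]p, q]) (cst k t)%:E
  = (q - p)%:E.
Proof.
move=> k0 pq.
rewrite (_ : _ @^-1` _ = `](p - c) / k, (q - c) / k]%classic)%R; last first.
  apply/seteqP; split => t /=; rewrite !in_itv/=.
    by rewrite ltr_pdivrMr// ler_pdivlMr//; lra.
  by rewrite ltr_pdivrMr// ler_pdivlMr//; lra.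
rewrite (integral_cst mu _ k%:E)//= lebesgue_measure_itv/= lte_fin.
rewrite ltr_pM2r ?invr_gt0// ltrD2r pq -EFinB -EFinM; congr EFin.
by field; rewrite gt_eqF.
Qed.

Let measurable_affine (c k : R) : measurable_fun setT (fun t : R => c + k * t)%R.
Proof. by apply: measurable_funD => //; exact: measurable_funM. Qed.

Lemma ge0_change_of_variables_affine (c k : R) (f : R -> \bar R) : (0 < k)%R ->
  measurable_fun setT f -> (forall t, 0 <= f t) ->
  \int[mu]_t f t = \int[mu]_t (f (c + k * t)%R * k%:E).
Proof.
move=> k0 mf f0.
rewrite (@ge0_change_of_variables R (fun t => (c + k * t)%R) (cst k))//.
- exact: measurable_affine.
- by move=> t; exact: ltW.
- by move=> p q pq; exact: affine_itv.
Qed.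

Lemma change_of_variables_affine (c k : R) (f : R -> R) : (0 < k)%R ->
  measurable_fun setT f ->
  \int[mu]_t (f t)%:E = \int[mu]_t (f (c + k * t) * k)%:E.
Proof.
move=> k0 mf.
rewrite (@change_of_variables R (fun t => (c + k * t)%R) (cst k))//.
- exact: measurable_affine.
- by move=> t; exact: ltW.
- by move=> p q pq; exact: affine_itv.
Qed.

Lemma continuous_powR (p t : R) : (0 < t)%R -> {for t, continuous (@powR R ^~ p)}.
Proof.
move=> t0; apply: differentiable_continuous; apply/derivable1_diffP.
by apply: derivable_powR; rewrite in_itv/= t0.
Qed.

Lemma integral_powR (p x y : R) : (0 < x)%R -> (x <= y)%R ->
  \int[mu]_(t in `[x, y]) (p * t `^ (p - 1))%:E = (y `^ p - x `^ p)%:E.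
Proof.
move=> x0; rewrite le_eqVlt => /predU1P[<-|xy].
  by rewrite set_itv1 integral_set1 subrr.
rewrite (@continuous_FTC2 _ _ (@powR R ^~ p))//.
- apply/continuous_in_subspaceT => t /[!inE]/= /[!in_itv]/= /andP[xt _].
  apply: (@continuousM _ R^o (cst p) (fun t => t `^ (p - 1))%R).
    exact: cst_continuous.
  by apply: continuous_powR; exact: lt_le_trans xt.
- split.
  + move=> t /[!in_itv]/= /andP[xt _].
    by apply: derivable_powR; rewrite in_itv/= (lt_trans x0).
  + by apply: cvg_at_right_filter; exact: continuous_powR.
  + by apply: cvg_at_left_filter; apply: continuous_powR; exact: lt_trans xy.
- move=> t /[!in_itv]/= /andP[xt _].
  by apply: powR_derive1; rewrite in_itv/= (lt_trans x0).
Qed.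

(** The power function on [a, +oo[, continued below [a] with slope 1: an
    increasing bijection of the line, to which [change_of_variables] applies
    while the singularity of the power at 0 is avoided. *)
Let pow_ext (a rho : R) : R -> R := fun t =>
  (if t < a then t - a + a `^ rho else t `^ rho)%R.
Let pow_ext' (a rho : R) : R -> R := fun t =>
  (if t < a then 1 else rho * t `^ (rho - 1))%R.
Let pow_ext_inv (a rho : R) : R -> R := fun u =>
  (if u < a `^ rho then u - a `^ rho + a else u `^ rho^-1)%R.

Let measurable_pow_ext a rho : measurable_fun setT (pow_ext a rho).
Proof.
apply: measurable_fun_ifT => //=.
  exact: measurable_fun_ltr.
by apply: measurable_funD => //; exact: measurable_funD.
Qed.

Let measurable_pow_ext' a rho : measurable_fun setT (pow_ext' a rho).
Proof.
apply: measurable_fun_ifT => //=.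
  exact: measurable_fun_ltr.
exact: measurable_funM.
Qed.

Let powRVK (rho t : R) : rho != 0%R -> (0 <= t)%R -> (t `^ rho^-1 `^ rho = t)%R.
Proof. by move=> r0 t0; rewrite -powRrM mulVf// powRr1. Qed.

Let ltr_powR_l (rho x y : R) : (0 < rho)%R -> (0 <= x)%R -> (0 <= y)%R ->
  (x `^ rho < y `^ rho)%R = (x < y)%R.
Proof.
move=> r0 x0 y0; apply/idP/idP; last exact: gt0_ltr_powR.
by apply: contraTT; rewrite -!leNgt => ?; apply: ge0_ler_powR => //; exact: ltW.
Qed.

Let pow_ext_lt (a rho t u : R) : (0 < a)%R -> (0 < rho)%R ->
  (u < pow_ext a rho t)%R = (pow_ext_inv a rho u < t)%R.
Proof.
move=> a0 r0; rewrite /pow_ext /pow_ext_inv.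
have ar0 : (0 < a `^ rho)%R by exact: powR_gt0.
have [ta|ta] := ltP t a; have [ua|ua] := ltP u (a `^ rho)%R.
- by apply/idP/idP; lra.
- have : (a <= u `^ rho^-1)%R.
    rewrite leNgt -(@ltr_powR_l rho) ?powR_ge0 ?(ltW a0)//.
    by rewrite powRVK ?gt_eqF -?leNgt// (le_trans (ltW ar0)).
  by move=> ?; apply/idP/idP; lra.
- have : (a `^ rho <= t `^ rho)%R.
    by apply: ge0_ler_powR => //; [exact: ltW| |]; rewrite nnegrE; lra.
  by move=> ?; apply/idP/idP; lra.
- rewrite -[in RHS](@ltr_powR_l rho) ?powR_ge0//; last lra.
  by rewrite powRVK ?gt_eqF// (le_trans (ltW ar0)).
Qed.

Let pow_extK (a rho u : R) : (0 < a)%R -> (0 < rho)%R ->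
  pow_ext a rho (pow_ext_inv a rho u) = u.
Proof.
move=> a0 r0; rewrite /pow_ext /pow_ext_inv.
have ar0 : (0 < a `^ rho)%R by exact: powR_gt0.
have [ua|ua] := ltP u (a `^ rho)%R; first by rewrite ifT; lra.
have u0 : (0 <= u)%R by exact: le_trans (ltW ar0) ua.
rewrite powRVK ?gt_eqF// ifF// -(@ltr_powR_l rho) ?powR_ge0 ?(ltW a0)//.
by rewrite powRVK ?gt_eqF// ltNge ua.
Qed.

Let integral_pow_ext' (a rho x y : R) : (0 < a)%R -> (0 < rho)%R -> (x <= y)%R ->
  \int[mu]_(t in `]x, y]) (pow_ext' a rho t)%:E =
  (pow_ext a rho y - pow_ext a rho x)%:E.
Proof.
move=> a0 r0.
have below z t : (z <= a)%R ->  (t <= z)%R ->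
    \int[mu]_(s in `]t, z]) (pow_ext' a rho s)%:E = (z - t)%:E.
  move=> za tz; rewrite integral_itv_bndoo; last first.
    by apply/measurable_EFinP; exact: measurable_funTS.
  rewrite (eq_integral (cst 1)); last first.
    move=> s /[!inE]/= /[!in_itv]/= s_; rewrite /pow_ext' ifT//; lra.
  rewrite integral_cst//= lebesgue_measure_itv/= lte_fin mul1e -EFinB.
  by case: ltP => // zt; congr EFin; lra.
have above z t : (a <= t)%R -> (t <= z)%R ->
    \int[mu]_(s in `]t, z]) (pow_ext' a rho s)%:E = (z `^ rho - t `^ rho)%:E.
  move=> at_ tz; rewrite integral_itv_obnd_cbnd; last first.
    by apply/measurable_EFinP; exact: measurable_funTS.
  rewrite -integral_powR//; last lra.
  apply: eq_integral => s /[!inE]/= /[!in_itv]/= s_; rewrite /pow_ext' ifF//.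
  by apply/negbTE; rewrite -leNgt; lra.
move=> xy; rewrite /pow_ext.
have [ya|ya] := ltP y a; have [xa|xa] := ltP x a.
- by rewrite below ?(ltW ya)//; congr EFin; lra.
- by exfalso; lra.
- rewrite (_ : `]x, y]%classic = `]x, a] `|` `]a, y]); last first.
    by rewrite -itv_bndbnd_setU// bnd_simp; lra.
  rewrite ge0_integral_setU//=.
  + by rewrite (below a x) ?(above y a) ?lexx ?(ltW xa)// -EFinD; congr EFin; lra.
  + apply/measurable_EFinP.
    exact: (measurable_funTS (measurable_pow_ext' a rho)).
  + move=> s _; rewrite lee_fin /pow_ext'; case: ifP => // _.
    by rewrite mulr_ge0 ?powR_ge0// ltW.
  + apply/disj_setPS => s /= []; rewrite !in_itv/=; lra.
- by rewrite above.
Qed.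

(** Applied to [f] restricted to the image interval, on whose preimage the
    continued power function is the power function itself. *)
Lemma integral_substitution_powR (a b rho : R) (f : R -> R) :
  (0 < a)%R -> (0 < rho)%R -> (a <= b)%R -> measurable_fun setT f ->
  \int[mu]_(u in `[(a `^ rho)%R, (b `^ rho)%R]) (f u)%:E =
  \int[mu]_(t in `[a, b]) (rho * t `^ (rho - 1) * f (t `^ rho))%:E.
Proof.
move=> a0 r0 ab mf.
rewrite integral_mkcond [RHS]integral_mkcond.
pose g u := (f \_ `[(a `^ rho)%R, (b `^ rho)%R] u)%R.
transitivity (\int[mu]_u (g u)%:E).
  by apply: eq_integral => u _; rewrite /g !patchE; case: ifP.
rewrite (@change_of_variables R (pow_ext a rho) (pow_ext' a rho))//.
- apply: eq_integral => t _; rewrite /g !patchE /pow_ext /pow_ext'.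
  have [ta|ta] := ltP t a.
    rewrite !memNset ?mul0r//= in_itv/=; first by lra.
    by move=> /andP[]; lra.
  rewrite (_ : (t `^ rho \in _)%R = (t \in `[a, b]%classic)).
    by case: ifP => _; rewrite ?mul0r// mulrC.
  have t0 : (0 <= t)%R by lra.
  have b0 : (0 <= b)%R by lra.
  have tE : (t `^ rho \in `[(a `^ rho)%R, (b `^ rho)%R])%R = (t \in `[a, b]).
    by rewrite !in_itv/= !leNgt !ltr_powR_l ?(ltW a0).
  by apply/idP/idP; rewrite !inE/= tE.
- exact: measurable_pow_ext.
- exact: measurable_pow_ext'.
- move=> t; rewrite /pow_ext'; case: ifP => // _.
  by rewrite mulr_ge0 ?powR_ge0// ltW.
- move=> c d cd.
  rewrite (_ : _ @^-1` _ =
    `]pow_ext_inv a rho c, pow_ext_inv a rho d]%classic); last first.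
    by apply/seteqP; split => t /=; rewrite !in_itv/= !leNgt !pow_ext_lt.
  rewrite integral_pow_ext' ?pow_extK// leNgt -pow_ext_lt// pow_extK//.
  by rewrite -leNgt ltW.
- by apply/(measurable_restrictT _ _).1 => //; exact: (measurable_funTS mf).
Qed.

End substitutions.

(** * Euler's Beta and Gamma integrals *)

(** Vanishing off the positive half-line turns integrals over [0, v] into
    convolutions over the whole line, where the substitutions have no bounds to
    keep track of. *)
Definition power_kernel (R : realType) (p s : R) : R :=
  if 0 < s then s `^ (p - 1) else 0.

Section euler_integrals.
Context {R : realType}.
Notation mu := (@lebesgue_measure R).
Implicit Types p q s v : R.
Notation k := (@power_kernel R).

Lemma measurable_power_kernel p : measurable_fun setT (k p).
Proof. by apply: measurable_fun_ifT => //=; exact: measurable_fun_ltr. Qed.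

Lemma power_kernel_ge0 p s : 0 <= k p s.
Proof. by rewrite /power_kernel; case: ifP => // _; exact: powR_ge0. Qed.

Lemma power_kernel_gt0 p s : 0 < s -> 0 < k p s.
Proof. by move=> s0; rewrite /power_kernel s0 powR_gt0. Qed.

Lemma power_kernel_le0 p s : s <= 0 -> k p s = 0.
Proof. by rewrite /power_kernel leNgt => /negbTE ->. Qed.

Lemma power_kernelM p v s : 0 < v -> k p (v * s) = v `^ (p - 1) * k p s.
Proof.
move=> v0; rewrite /power_kernel pmulr_rgt0//; case: ifP; rewrite ?mulr0// => s0.
by rewrite powRM// ltW.
Qed.

Local Open Scope ereal_scope.

(** Extended real valued, as Tonelli's theorem is used on them before they are
    known to be finite. *)
Definition gamma_integral p : \bar R := \int[mu]_s (k p s * expR (- s))%:E.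
Definition beta_integral p q : \bar R := \int[mu]_s (k p (1 - s)%R * k q s)%:E.

Lemma measurable_gamma_integrand p :
  measurable_fun setT (fun s => (k p s * expR (- s))%:E).
Proof.
apply/measurable_EFinP; apply: measurable_funM; first exact: measurable_power_kernel.
exact: measurableT_comp.
Qed.

Let measurable_kernel_sub p (c : R) : measurable_fun setT (fun s => k p (c - s)%R).
Proof.
apply: (measurableT_comp (measurable_power_kernel p)).
exact: measurable_funB.
Qed.

Let measurable_conv_integrand p q v :
  measurable_fun setT (fun s => (k p (v - s)%R * k q s)%:E).
Proof.
apply/measurable_EFinP; apply: measurable_funM; first exact: measurable_kernel_sub.
exact: measurable_power_kernel.
Qed.

(** The convolution of two homogeneous functions is homogeneous: the
    substitution [s -> v * s] extracts the power of [v]. *)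
Lemma power_kernel_conv p q v :
  \int[mu]_s (k p (v - s)%R * k q s)%:E = beta_integral p q * (k (p + q) v)%:E.
Proof.
have [v0|v0] := leP v 0%R.
  rewrite (power_kernel_le0 (p + q))// mule0 integral0_eq// => s _.
  have [s0|s0] := leP s 0%R; first by rewrite (power_kernel_le0 _ s0) mulr0.
  by rewrite (@power_kernel_le0 p (v - s)%R) ?mul0r//; lra.
rewrite (@ge0_change_of_variables_affine R 0 v)//; last first.
  by move=> s; rewrite lee_fin mulr_ge0 ?power_kernel_ge0.
rewrite /beta_integral -ge0_integralZr//; last 3 first.
- exact: measurable_conv_integrand.
- by move=> s _; rewrite lee_fin mulr_ge0 ?power_kernel_ge0.
- by rewrite lee_fin power_kernel_ge0.
apply: eq_integral => s _; rewrite -!EFinM add0r; congr EFin.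
rewrite (_ : v - v * s = v * (1 - s))%R; last by ring.
rewrite !power_kernelM// (_ : k (p + q) v = v `^ (p - 1) * v `^ (q - 1) * v)%R.
  by ring.
rewrite /power_kernel v0 -[X in _ = (_ * X)%R](powRr1 (ltW v0)).
rewrite -!powRD ?(gt_eqF v0) ?implybT//; congr powR; ring.
Qed.

Let measurable_pair_sub p : measurable_fun setT
  (fun z : measurableTypeR R * measurableTypeR R => k p (z.1 - z.2)).
Proof.
apply: (measurableT_comp (measurable_power_kernel p)).
exact: measurable_funB.
Qed.

(** Convolution is multiplicative for the integral against [exp (- v) dv]; apply
    this to [power_kernel_conv]. *)
Lemma gamma_integralM p q :
  gamma_integral p * gamma_integral q = beta_integral p q * gamma_integral (p + q).
Proof.
have mgamma := measurable_gamma_integrand.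
rewrite [in RHS]/gamma_integral -[RHS]ge0_integralZl//; last 3 first.
- exact: measurable_gamma_integrand.
- by move=> s _; rewrite lee_fin mulr_ge0 ?power_kernel_ge0 ?expR_ge0.
- by apply: integral_ge0 => s _; rewrite lee_fin mulr_ge0 ?power_kernel_ge0.
pose f (z : measurableTypeR R * measurableTypeR R) : \bar R :=
  (k p (z.1 - z.2) * k q z.2 * expR (- z.1))%:E.
have mf : measurable_fun setT f.
  apply/measurable_EFinP; apply: measurable_funM.
    apply: measurable_funM; first exact: measurable_pair_sub.
    exact: (measurableT_comp (measurable_power_kernel q)).
  apply: measurableT_comp => //; exact: measurableT_comp.
have f0 z : 0 <= f z.
  by rewrite lee_fin !mulr_ge0 ?power_kernel_ge0 ?expR_ge0.
transitivity (\int[mu]_v \int[mu]_s f (v, s)); last first.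
  apply: eq_integral => v _; rewrite EFinM muleA -power_kernel_conv.
  rewrite -ge0_integralZr//.
  - exact: measurable_conv_integrand.
  - by move=> s _; rewrite lee_fin mulr_ge0 ?power_kernel_ge0.
rewrite (fubini_tonelli f mf f0) [X in _ * X]/gamma_integral.
rewrite -[LHS]ge0_integralZl//; last 3 first.
- exact: measurable_gamma_integrand.
- by move=> s _; rewrite lee_fin mulr_ge0 ?power_kernel_ge0 ?expR_ge0.
- by apply: integral_ge0 => s _; rewrite lee_fin mulr_ge0 ?power_kernel_ge0 ?expR_ge0.
apply: eq_integral => s _; rewrite /gamma_integral.
rewrite (@ge0_change_of_variables_affine R (- s)%R 1)//; last first.
  by move=> t; rewrite lee_fin mulr_ge0 ?power_kernel_ge0 ?expR_ge0.
rewrite -ge0_integralZr//; last 3 first.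
- under eq_fun do rewrite mule1.
  apply: (measurableT_comp (measurable_gamma_integrand p)).
  by apply: measurable_funD => //; exact: measurable_funM.
- by move=> t _; rewrite mule1 lee_fin mulr_ge0 ?power_kernel_ge0 ?expR_ge0.
- by rewrite lee_fin mulr_ge0 ?power_kernel_ge0 ?expR_ge0.
apply: eq_integral => v _; rewrite mule1 -EFinM /f/=; congr EFin.
rewrite mul1r (_ : - v = - (- s + v) + - s)%R; last by ring.
rewrite (addrC (- s)%R v) expRD; ring.
Qed.

End euler_integrals.

Section gamma_function.
Context {R : realType}.
Notation mu := (@lebesgue_measure R).
Implicit Types p q s v : R.
Notation k := (@power_kernel R).
Local Open Scope ereal_scope.

Let integral_gt0_01 (f : R -> R) : measurable_fun setT f ->
  (forall s, (0 <= f s)%R) -> (forall s, (0 < s < 1)%R -> (0 < f s)%R) ->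
  0 < \int[mu]_s (f s)%:E.
Proof.
move=> mf f0 fgt0; rewrite lt_neqAle integral_ge0 ?andbT; last first.
  by move=> s _; rewrite lee_fin.
apply/eqP => /esym int0.
have : \int[mu]_s `|(f s)%:E| = 0.
  by rewrite -[RHS]int0; apply: eq_integral => s _; rewrite gee0_abs ?lee_fin.
have mEf : measurable_fun [set: measurableTypeR R] (EFin \o f).
  exact/measurable_EFinP.
move/(ae_eq_integral_abs mu measurableT mEf) => [N [mN N0 subN]].
have : mu `]0%R, 1%R[ <= mu N.
  apply: le_measure; rewrite ?inE// => s /=; rewrite in_itv/= => s01.
  apply: subN => /= /(_ I) /eqP; rewrite eqe gt_eqF//; exact: fgt0.
rewrite [leRHS]N0 lebesgue_measure_itv/= lte01 -EFinB lee_fin; lra.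
Qed.

Lemma gamma_integral_gt0 p : 0 < gamma_integral p.
Proof.
apply: integral_gt0_01.
- by apply/measurable_EFinP; exact: measurable_gamma_integrand.
- by move=> s; rewrite mulr_ge0 ?power_kernel_ge0 ?expR_ge0.
- by move=> s /andP[s0 _]; rewrite mulr_gt0 ?expR_gt0 ?power_kernel_gt0.
Qed.

Lemma beta_integral_gt0 p q : 0 < beta_integral p q.
Proof.
apply: integral_gt0_01.
- apply: measurable_funM; last exact: measurable_power_kernel.
  apply: (measurableT_comp (measurable_power_kernel p)); exact: measurable_funB.
- by move=> s; rewrite mulr_ge0 ?power_kernel_ge0.
- by move=> s /andP[s0 s1]; rewrite mulr_gt0 ?power_kernel_gt0 ?subr_gt0.
Qed.

Lemma gamma_integral1 : @gamma_integral R 1%R = 1.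
Proof.
rewrite -(@integral_exponential_pdf R 1%R ltr01).
have mexp : measurable_fun [set: R] (fun s : R => (expR (- s))%:E).
  by apply/measurable_EFinP; exact: measurableT_comp.
transitivity (\int[mu]_(s in `]0%R, +oo[) (expR (- s))%:E).
  rewrite [RHS]integral_mkcond; apply: eq_integral => s _.
  rewrite patchE /power_kernel subrr powRr0.
  have [s0|s0] := ltP 0%R s.
    by rewrite mem_set ?mul1r//= in_itv/= s0.
  by rewrite memNset ?mul0r//= in_itv/= andbT ltNge s0.
rewrite integral_itv_obnd_cbnd; last exact: (measurable_funTS mexp).
rewrite integral_mkcond; apply: eq_integral => s _.
rewrite /exponential_pdf !patchE; case: ifP => // _.
by rewrite mul1r mulN1r.
Qed.

(* In [gamma_integralM 1 n] the Beta integral is positive, so an infinite value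
   at [n + 1] would make the product of the values at 1 and [n] infinite. *)
Let gamma_integral_nat_lty n : @gamma_integral R n.+1%:R < +oo.
Proof.
elim: n => [|n IHn]; first by rewrite gamma_integral1 ltry.
rewrite ltey; apply/eqP => goo.
have := @gamma_integralM R 1%R n.+1%:R.
rewrite gamma_integral1 mul1e (addrC 1%R) natr1 goo gt0_muley ?beta_integral_gt0//.
by move=> h; move: IHn; rewrite h ltxx.
Qed.

Let integral01_powR_lty p : (0 < p)%R ->
  \int[mu]_(s in `]0%R, 1%R]) (s `^ (p - 1))%:E < +oo.
Proof.
move=> p0; pose F n := (`[n.+1%:R^-1, 1]%classic : set R)%R.
have FE : (\bigcup_n F n = `]0, 1]%classic)%R.
  apply/seteqP; split => s.
    move=> [n _]; rewrite /F/= !in_itv/= => /andP[ns ->]; rewrite andbT.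
    by apply: lt_le_trans ns; rewrite invr_gt0.
  rewrite /= in_itv/= => /andP[s0 s1].
  exists (Num.truncn s^-1) => //; rewrite /F/= in_itv/= s1 andbT.
  by rewrite invf_ple ?posrE// ltW// truncnS_gt.
have cvgI : (\int[mu]_(s in F n) (s `^ (p - 1))%:E @[n --> \oo] -->
    \int[mu]_(s in \bigcup_n F n) (s `^ (p - 1))%:E).
  apply: ge0_nondecreasing_set_cvg_integral => //.
  - move=> m n mn; apply/subsetPset => s; rewrite /F/= !in_itv/= => /andP[ms ->].
    rewrite andbT (le_trans _ ms)// lef_pV2 ?posrE// ler_nat.
    by rewrite ltnS.
  - by move=> n; exact: measurable_itv.
  - by move=> n; apply/measurable_EFinP; apply: measurable_funTS.
  - by move=> n s _; rewrite lee_fin powR_ge0.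
move: (cvgI); rewrite FE => /cvg_lim <-//.
apply: (@le_lt_trans _ _ (p^-1)%:E); last exact: ltry.
apply: lime_le; first exact: cvgP cvgI.
near=> n; rewrite /F.
have e0 : (0 < n.+1%:R^-1 :> R)%R by rewrite invr_gt0.
have e1 : (n.+1%:R^-1 <= 1 :> R)%R by rewrite invf_le1// ler1n.
rewrite -[leRHS]mule1 lee_pdivlMl// -ge0_integralZl//; last 3 first.
- by apply/measurable_EFinP; exact: measurable_funTS.
- by move=> s _; rewrite lee_fin powR_ge0.
- by rewrite lee_fin ltW.
under eq_integral do rewrite -EFinM.
by rewrite integral_powR// powR1 lee_fin gerBl powR_ge0.
Unshelve. all: by end_near. Qed.

(** Near 0 the integrand is dominated by the power, near infinity by the
    integrand of a larger integral exponent. *)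
Lemma gamma_integral_lty p : (0 < p)%R -> gamma_integral p < +oo.
Proof.
move=> p0; have [n pn] : exists n, (p <= n.+1%:R)%R.
  by exists (Num.truncn p); rewrite ltW// truncnS_gt.
have mgamma := @measurable_gamma_integrand R.
apply: (@le_lt_trans _ _ (gamma_integral n.+1%:R +
  \int[mu]_(s in `]0%R, 1%R]) (s `^ (p - 1))%:E)); last first.
  by rewrite lte_add_pinfty// ?gamma_integral_nat_lty// integral01_powR_lty.
have mg : measurable_fun setT ((fun s => (s `^ (p - 1))%:E) \_ `]0%R, 1%R]).
  apply/(measurable_restrictT _ _).1 => //; apply/measurable_EFinP.
  exact: measurable_funTS.
rewrite [X in _ <= _ + X]integral_mkcond -ge0_integralD//=; last 3 first.
- by move=> s _; rewrite lee_fin mulr_ge0 ?power_kernel_ge0 ?expR_ge0.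
- exact: measurable_gamma_integrand.
- by move=> s _; apply: erestrict_ge0 => t _; rewrite lee_fin powR_ge0.
apply: ge0_le_integral => //.
- by move=> s _; rewrite lee_fin mulr_ge0 ?power_kernel_ge0 ?expR_ge0.
- exact: measurable_gamma_integrand.
- apply: emeasurable_funD => //.
  exact: measurable_gamma_integrand.
move=> s _; rewrite patchE /power_kernel.
have [s0|s0] := ltP 0%R s; last first.
  by rewrite memNset ?mul0r ?adde0//= in_itv/= ltNge s0.
have [s1|s1] := leP s 1%R.
  rewrite mem_set/= ?in_itv/= ?s0// -EFinD lee_fin -[leLHS]add0r lerD//.
    by rewrite mulr_ge0 ?powR_ge0 ?expR_ge0.
  by rewrite ler_piMr ?powR_ge0// expR_le1 oppr_le0 ltW.
rewrite memNset/=; last by rewrite in_itv/= s0 leNgt s1.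
rewrite adde0 lee_fin.
apply: ler_wpM2r; first exact: expR_ge0.
by apply: ler_powR; [exact: ltW|exact: lerB].
Qed.

Lemma beta_integral_lty p q : (0 < p)%R -> (0 < q)%R -> beta_integral p q < +oo.
Proof.
move=> p0 q0; rewrite ltey; apply/eqP => boo.
have := gamma_integralM p q; rewrite boo gt0_mulye ?gamma_integral_gt0// => h.
have : gamma_integral p * gamma_integral q < +oo.
  rewrite lte_mul_pinfty ?gamma_integral_lty ?(ltW (gamma_integral_gt0 _))//.
  by rewrite ge0_fin_numE ?gamma_integral_lty ?(ltW (gamma_integral_gt0 _)).
by rewrite h ltxx.
Qed.

Lemma GammaE p : (0 < p)%R -> (Gamma p)%:E = gamma_integral p.
Proof.
move=> p0; rewrite /Gamma /Rintegral.
rewrite (_ : integral _ _ _ = gamma_integral p).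
  by rewrite fineK// ge0_fin_numE ?gamma_integral_lty// ltW// gamma_integral_gt0.
rewrite integral_mkcond; apply: eq_integral => s _.
rewrite patchE /power_kernel.
have [s0|s0] := ltP 0%R s; first by rewrite mem_set//= in_itv/= s0.
by rewrite memNset ?mul0r//= in_itv/= andbT ltNge s0.
Qed.

Lemma Gamma_gt0 p : (0 < p)%R -> (0 < Gamma p)%R.
Proof. by move=> p0; rewrite -lte_fin GammaE// gamma_integral_gt0. Qed.

Lemma Gamma1 : @Gamma R 1%R = 1%R.
Proof. by apply: EFin_inj; rewrite GammaE// gamma_integral1. Qed.

(** The Riemann-Liouville integral of order [p] is the convolution with this
    kernel. *)
Definition riesz_kernel p s : R := (k p s / Gamma p)%R.

(** The semigroup law of fractional integration. *)
Lemma riesz_kernel_conv p q v : (0 < p)%R -> (0 < q)%R ->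
  \int[mu]_s (riesz_kernel p (v - s)%R * riesz_kernel q s)%:E =
  (riesz_kernel (p + q) v)%:E.
Proof.
move=> p0 q0.
have Gp := Gamma_gt0 p0; have Gq := Gamma_gt0 q0.
transitivity ((Gamma p * Gamma q)^-1%:E *
    \int[mu]_s (k p (v - s)%R * k q s)%:E).
  rewrite -ge0_integralZl//.
  - apply: eq_integral => s _; rewrite -EFinM /riesz_kernel; congr EFin.
    by rewrite mulrACA -invfM mulrC.
  - apply/measurable_EFinP.
    apply: measurable_funM; last exact: measurable_power_kernel.
    apply: (measurableT_comp (measurable_power_kernel p)); exact: measurable_funB.
  - by move=> s _; rewrite lee_fin mulr_ge0 ?power_kernel_ge0.
  - by rewrite lee_fin invr_ge0 mulr_ge0 ?(ltW Gp) ?(ltW Gq).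
rewrite power_kernel_conv.
have p_q0 : (0 < p + q)%R by exact: addr_gt0.
have Bfin : beta_integral p q \is a fin_num.
  by rewrite ge0_fin_numE ?beta_integral_lty ?ltW ?beta_integral_gt0.
have := gamma_integralM p q.
rewrite -(GammaE p0) -(GammaE q0) -(GammaE p_q0) -(fineK Bfin) -!EFinM.
move=> [GG]; rewrite GG; congr EFin; rewrite /riesz_kernel.
have B0 : fine (beta_integral p q) != 0%R.
  by rewrite gt_eqF// -lte_fin fineK// beta_integral_gt0.
by rewrite invfM mulrACA mulVf// mul1r mulrC.
Qed.

End gamma_function.

(** * Fractional integrals of a density *)

Section riesz_kernel_theory.
Context {R : realType}.
Notation mu := (@lebesgue_measure R).
Notation K := (@riesz_kernel R).
Implicit Types p q s u v : R.

Lemma measurable_riesz_kernel p : measurable_fun setT (K p).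
Proof. by apply: measurable_funM => //; exact: measurable_power_kernel. Qed.

Lemma riesz_kernel_ge0 p s : 0 < p -> 0 <= K p s.
Proof.
by move=> p0; rewrite mulr_ge0 ?power_kernel_ge0// invr_ge0 ltW// Gamma_gt0.
Qed.

Lemma riesz_kernel_le0 p s : s <= 0 -> K p s = 0.
Proof. by move=> s0; rewrite /riesz_kernel power_kernel_le0// mul0r. Qed.

Lemma riesz_kernelE p s : 0 < s -> K p s = s `^ (p - 1) / Gamma p.
Proof. by move=> s0; rewrite /riesz_kernel /power_kernel s0. Qed.

Lemma riesz_kernel1 s : K 1 s = if 0 < s then 1 else 0.
Proof.
by rewrite /riesz_kernel /power_kernel Gamma1 subrr powRr0 divr1.
Qed.

Lemma riesz_kernelM p v s : 0 < v -> K p (v * s) = v `^ (p - 1) * K p s.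
Proof. by move=> v0; rewrite /riesz_kernel power_kernelM// mulrA. Qed.

Lemma continuous_riesz_kernel p s : 0 < s -> {for s, continuous (K p)}.
Proof.
move=> s0; apply: (@cvg_trans _ ((fun t => t `^ (p - 1) / Gamma p) @ s)).
  apply: near_eq_cvg; near=> t; rewrite riesz_kernelE//.
  by near: t; exact: lt_nbhsr.
rewrite riesz_kernelE//.
apply: (@continuousM _ R^o (fun t => t `^ (p - 1)) (cst (Gamma p)^-1)).
  exact: continuous_powR.
exact: cst_continuous.
Unshelve. all: by end_near. Qed.

Lemma measurable_riesz_kernel_rev p v : measurable_fun setT (fun s => K p (v - s)).
Proof.
apply: (measurableT_comp (measurable_riesz_kernel p)); exact: measurable_funB.
Qed.

Lemma measurable_riesz_kernel_shift p u : measurable_fun setT (fun s => K p (s - u)).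
Proof.
apply: (measurableT_comp (measurable_riesz_kernel p)); exact: measurable_funB.
Qed.

End riesz_kernel_theory.

(* Unification would otherwise unfold the integral that defines Gamma. *)
#[local] Opaque riesz_kernel Gamma.

Section riesz_kernel_convolution.
Context {R : realType}.
Notation mu := (@lebesgue_measure R).
Notation K := (@riesz_kernel R).
Implicit Types p q s u v : R.

Lemma riesz_kernel_conv_shift p q u v : 0 < p -> 0 < q ->
  (\int[mu]_s (K p (v - s) * K q (s - u))%:E = (K (p + q) (v - u))%:E)%E.
Proof.
move=> p0 q0; rewrite -(riesz_kernel_conv (v - u) p0 q0).
rewrite (@ge0_change_of_variables_affine R u 1)//.
- apply: eq_integral => s _; rewrite mule1; congr (K p _ * K q _)%:E; ring.
- apply/measurable_EFinP; apply: measurable_funM.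
    exact: measurable_riesz_kernel_rev.
  exact: measurable_riesz_kernel_shift.
- by move=> s; rewrite lee_fin mulr_ge0 ?riesz_kernel_ge0.
Qed.

Lemma integrable_riesz_kernel_conv p q u v : 0 < p -> 0 < q ->
  mu.-integrable setT (fun s => (K p (v - s) * K q (s - u))%:E).
Proof.
move=> p0 q0; apply/integrableP; split.
  apply/measurable_EFinP; apply: measurable_funM.
    exact: measurable_riesz_kernel_rev.
  exact: measurable_riesz_kernel_shift.
have -> : (\int[mu]_s `|(K p (v - s) * K q (s - u))%:E|
    = (K (p + q) (v - u))%:E)%E; last exact: ltry.
  rewrite -(riesz_kernel_conv_shift u v p0 q0); apply: eq_integral => s _.
  by rewrite gee0_abs// lee_fin mulr_ge0 ?riesz_kernel_ge0.
Qed.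

End riesz_kernel_convolution.

Section potential.
Context {R : realType}.
Notation mu := (@lebesgue_measure R).
Notation K := (@riesz_kernel R).
Implicit Types p q s u v : R.
Context (A M : R) (h : R -> R).
Hypotheses (mh : measurable_fun setT h) (M0 : 0 <= M).
(* As [K 1] is the indicator of the positive reals, this says that [h] is bounded
   and vanishes up to [A]; in this form the integrals of [h] are dominated by
   convolutions of two kernels. *)
Hypothesis hM : forall u, `|h u| <= M * K 1 (u - A).

Let h0 u : u <= A -> h u = 0.
Proof.
move=> uA; have := hM u; rewrite riesz_kernel_le0 ?subr_le0// mulr0.
by rewrite normr_le0 => /eqP.
Qed.

Definition potential q v : R := \int[mu]_u (K q (v - u) * h u).

Let mKh q v : measurable_fun setT (fun u => K q (v - u) * h u).
Proof. by apply: measurable_funM => //; exact: measurable_riesz_kernel_rev. Qed.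

Let integral_Kh_lty q v : 0 < q ->
  (\int[mu]_u `|(K q (v - u) * h u)%:E| < +oo)%E.
Proof.
move=> q0; apply: (@le_lt_trans _ _ (M%:E * (K (q + 1) (v - A))%:E)%E); last first.
  by rewrite -EFinM ltry.
rewrite -(riesz_kernel_conv_shift A v q0 ltr01) -ge0_integralZl//; last 2 first.
- apply/measurable_EFinP; apply: measurable_funM.
    exact: measurable_riesz_kernel_rev.
  exact: measurable_riesz_kernel_shift.
- by move=> u _; rewrite lee_fin mulr_ge0 ?riesz_kernel_ge0.
apply: ge0_le_integral => //.
- by apply/measurableT_comp => //; apply/measurable_EFinP; exact: mKh.
- under eq_fun do rewrite -EFinM.
  apply/measurable_EFinP; apply: measurable_funM => //.
  apply: measurable_funM; first exact: measurable_riesz_kernel_rev.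
  exact: measurable_riesz_kernel_shift.
- move=> u _; rewrite -EFinM abse_EFin lee_fin normrM ger0_norm ?riesz_kernel_ge0//.
  by rewrite mulrCA ler_wpM2l ?riesz_kernel_ge0.
Qed.

Lemma integrable_Kh q v : 0 < q ->
  mu.-integrable setT (fun u => (K q (v - u) * h u)%:E).
Proof.
move=> q0; apply/integrableP; split; last exact: integral_Kh_lty.
by apply/measurable_EFinP; exact: mKh.
Qed.

Lemma potentialE q v : 0 < q ->
  ((potential q v)%:E = \int[mu]_u (K q (v - u) * h u)%:E)%E.
Proof.
move=> q0; rewrite /potential /Rintegral fineK//.
by apply: integrable_fin_num => //; exact: integrable_Kh.
Qed.

Lemma potential_le0 q v : v <= A -> potential q v = 0.
Proof.
move=> vA; rewrite /potential /Rintegral integral0_eq// => u _.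
have [uv|uv] := leP u v; first by rewrite h0 ?mulr0// (le_trans uv).
by rewrite riesz_kernel_le0 ?mul0r// subr_le0 ltW.
Qed.

Section semigroup.
Context (p q v : R) (p0 : 0 < p) (q0 : 0 < q).

Let F (z : measurableTypeR R * measurableTypeR R) : \bar R :=
  (K p (v - z.1) * (K q (z.1 - z.2) * h z.2))%:E.

Let mF : measurable_fun setT F.
Proof.
apply/measurable_EFinP; apply: measurable_funM.
  by apply: (measurableT_comp (measurable_riesz_kernel_rev p v)).
apply: measurable_funM; last exact: (measurableT_comp mh).
apply: (measurableT_comp (measurable_riesz_kernel q)).
exact: measurable_funB.
Qed.

Let iF : (mu \x mu)%E.-integrable setT F.
Proof.
apply/integrable21ltyP => //.
apply: (@le_lt_trans _ _ (\int[mu]_u `|(K (p + q) (v - u) * h u)%:E|)%E); last first.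
  by apply: integral_Kh_lty; exact: addr_gt0.
rewrite le_eqVlt; apply/orP; left; apply/eqP; apply: eq_integral => u _.
rewrite abse_EFin normrM ger0_norm ?riesz_kernel_ge0 ?addr_gt0//.
rewrite EFinM -(riesz_kernel_conv_shift u v p0 q0) -ge0_integralZr//; last 2 first.
- apply/measurable_EFinP; apply: measurable_funM.
    exact: measurable_riesz_kernel_rev.
  exact: measurable_riesz_kernel_shift.
- by move=> s _; rewrite lee_fin mulr_ge0 ?riesz_kernel_ge0.
apply: eq_integral => s _; rewrite /F/= -EFinM; congr EFin.
rewrite normrM ger0_norm ?riesz_kernel_ge0//.
by rewrite normrM [X in _ * (X * _)]ger0_norm ?riesz_kernel_ge0// mulrA.
Qed.

Let innerF s : (\int[mu]_u F (s, u) = (K p (v - s) * potential q s)%:E)%E.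
Proof.
rewrite EFinM potentialE// -integralZl//; first exact: integrable_Kh.
Qed.

Lemma integrable_potential :
  mu.-integrable setT (fun s => (K p (v - s) * potential q s)%:E).
Proof.
have := integrable_fubini_F iF; apply: eq_integrable => // s _.
by rewrite /fubini_F innerF.
Qed.

(** Fubini's theorem and the semigroup law of the kernels; the absolute values
    are integrable because the order of integration that computes
    [K p * K q] first leaves a bounded density against [K (p + q)]. *)
Lemma potential_semigroup :
  (\int[mu]_s (K p (v - s) * potential q s)%:E = (potential (p + q) v)%:E)%E.
Proof.
rewrite potentialE ?addr_gt0//.
transitivity (\int[mu]_s \int[mu]_u F (s, u))%E.
  by apply: eq_integral => s _; rewrite innerF.
rewrite (Fubini iF); apply: eq_integral => u _.
rewrite EFinM -(riesz_kernel_conv_shift u v p0 q0) -integralZr//.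
  by apply: eq_integral => s _; rewrite /F/= -EFinM mulrA.
exact: integrable_riesz_kernel_conv.
Qed.

End semigroup.
End potential.

Section potential_regularity.
Context {R : realType}.
Notation mu := (@lebesgue_measure R).
Notation K := (@riesz_kernel R).
Implicit Types p q s u v : R.
Context (A B M : R) (h : R -> R).
Hypothesis mh : measurable_fun setT h.
Hypothesis hM : forall u, `|h u| <= M * K 1 (u - A).
Hypothesis ch : forall u, A < u < B -> {for u, continuous h}.

Notation pot := (potential h).

Let h0 u : u <= A -> h u = 0.
Proof.
move=> uA; have := hM u; rewrite riesz_kernel_le0 ?subr_le0// mulr0.
by rewrite normr_le0 => /eqP.
Qed.

(* The substitution [u = A + (v - A) s] moves the singularity of the kernel to the
   fixed point [s = 1] and makes the integrand continuous in [v]. *)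
Let f q (v s : R) : R := K q (1 - s) * h (A + (v - A) * s).

Let mf q v : measurable_fun setT (f q v).
Proof.
apply: measurable_funM; first exact: measurable_riesz_kernel_rev.
apply: (measurableT_comp mh).
by apply: measurable_funD => //; exact: measurable_funM.
Qed.

(* Written with a shift by 0 to match [integrable_riesz_kernel_conv]. *)
Let dom q s := M * (K q (1 - s) * K 1 (s - 0)).

Let f_dom q v s : 0 < q -> A < v -> `|f q v s| <= dom q s.
Proof.
move=> q0 Av; rewrite /f /dom normrM ger0_norm ?riesz_kernel_ge0//.
rewrite mulrCA ler_wpM2l ?riesz_kernel_ge0//.
rewrite (le_trans (hM _))// addrAC subrr add0r subr0.
by rewrite riesz_kernelM ?subr_gt0// subrr powRr0 mul1r.
Qed.

Let integrable_dom q : 0 < q -> mu.-integrable setT (EFin \o dom q).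
Proof.
move=> q0; have := integrable_riesz_kernel_conv 0 1 q0 ltr01.
move=> /(integrableZl measurableT M); apply: eq_integrable => // s _.
Qed.

Let integrable_f q v : 0 < q -> A < v -> mu.-integrable setT (EFin \o f q v).
Proof.
move=> q0 Av; apply: le_integrable (integrable_dom q0) => //.
  by apply/measurable_EFinP; exact: mf.
move=> s _ /=; rewrite lee_fin (le_trans (f_dom _ q0 Av))//.
exact: ler_norm.
Qed.

Let potential_scale q v : 0 < q -> A < v ->
  pot q v = (v - A) `^ q * \int[mu]_s f q v s.
Proof.
move=> q0 Av; have vA : 0 < v - A by rewrite subr_gt0.
have mKh : measurable_fun setT (fun u => K q (v - u) * h u).
  by apply: measurable_funM => //; exact: measurable_riesz_kernel_rev.
rewrite -RintegralZl//; last exact: integrable_f.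
rewrite /potential /Rintegral (change_of_variables_affine A vA mKh).
congr fine; apply: eq_integral => s _; congr EFin.
rewrite (_ : v - (A + (v - A) * s) = (v - A) * (1 - s)); last by ring.
rewrite riesz_kernelM// /f -(mulr_powRB1 (ltW vA) q0); ring.
Qed.

(** Dominated convergence in the form of the integral over a fixed interval. *)
Lemma continuous_potential q v : 0 < q -> A < v < B -> {for v, continuous (pot q)}.
Proof.
move=> q0 /andP[Av vB].
have cF : {for v, continuous (fun l => \int[mu]_s f q l s)}.
  apply: (@continuity_under_integral R _ _ mu (f q) setT measurableT A B _ _
    (dom q)) => //.
  - move=> l /=; rewrite in_itv/= => /andP[Al lB].
    exact: integrable_f.
  - apply: aeW => s _ l; rewrite inE/= in_itv/= => /andP[Al lB].
    have lA : 0 < l - A by rewrite subr_gt0.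
    have [s0|s0] := leP s 0.
      (* near l the argument of h stays below A *)
      apply: (near_cst_continuous 0); near=> y; rewrite /f h0 ?mulr0//.
      rewrite gerDl pmulr_rle0// subr_gt0.
      by near: y; exact: lt_nbhsr.
    have [s1|s1] := leP 1 s.
      rewrite (_ : f q ^~ s = cst 0); first exact: cst_continuous.
      by apply/funext => y; rewrite /f riesz_kernel_le0 ?mul0r// subr_le0.
    apply: (@continuousM _ R^o (cst _)); first exact: cst_continuous.
    apply: continuous_comp.
      apply: (@continuousD _ R^o R^o); first exact: cst_continuous.
      apply: (@continuousM _ R^o) => //; last exact: cst_continuous.
      apply: (@continuousB _ R^o R^o) => //; exact: cst_continuous.
    apply: ch; apply/andP; split; first by rewrite ltrDl mulr_gt0.
    rewrite (lt_le_trans _ (ltW lB))// -ltrBrDl.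
    by rewrite gtr_pMr.
  - exact: integrable_dom.
  - move=> l /=; rewrite in_itv/= => /andP[Al lB]; apply: aeW => s _.
    exact: f_dom.
  - by rewrite inE/= in_itv/= Av.
apply: (@cvg_trans _
  (((fun l => (l - A) `^ q) \* (fun l => \int[mu]_s f q l s)) @ v)).
  apply: near_eq_cvg; near=> l; rewrite potential_scale//.
  by near: l; exact: lt_nbhsr.
rewrite potential_scale//.
apply: (@continuousM _ R^o (fun l => (l - A) `^ q)) => //.
apply: (@continuous_comp _ _ _ (fun l => l - A) (@powR R ^~ q)).
  apply: (@continuousB _ R^o R^o) => //; exact: cst_continuous.
by apply: continuous_powR; rewrite subr_gt0.
Unshelve. all: by end_near. Qed.

End potential_regularity.

(** * The scale of fractional primitives *)

Section primitive_scale.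
Context {R : realType}.
Notation mu := (@lebesgue_measure R).
Notation K := (@riesz_kernel R).
Implicit Types p q s u v : R.
Context (A B c M : R) (h : R -> R).
Hypotheses (mh : measurable_fun setT h) (M0 : 0 <= M).
Hypothesis hM : forall u, `|h u| <= M * K 1 (u - A).
Hypothesis ch : forall u, A < u < B -> {for u, continuous h}.

(** The convolution of [K q] with the measure that has mass [c] at [A] and
    density [h] beyond: the fractional primitives of all orders of that measure.
    The one of order 1 is the function with value [c] at [A] and derivative [h];
    the mass at [A] accounts for the singular term in the fractional derivatives
    of a function that does not vanish at [A]. *)
Definition primitive_scale q v : R := c * K q (v - A) + potential h q v.
Notation E := primitive_scale.

Lemma primitive_scale_le0 q v : v <= A -> E q v = 0.
Proof.
move=> vA; rewrite /primitive_scale (potential_le0 hM)// riesz_kernel_le0 ?subr_le0//.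
by rewrite mulr0 addr0.
Qed.

Let primitive_scaleK p q v s : (K p (v - s) * E q s)%:E =
  (c%:E * (K p (v - s) * K q (s - A))%:E + (K p (v - s) * potential h q s)%:E)%E.
Proof. by rewrite -EFinM -EFinD; congr EFin; rewrite mulrDr mulrCA. Qed.

Let integrable_delta p q v : 0 < p -> 0 < q ->
  mu.-integrable setT (fun s => c%:E * (K p (v - s) * K q (s - A))%:E)%E.
Proof.
by move=> p0 q0; apply: integrableZl => //; exact: integrable_riesz_kernel_conv.
Qed.

Lemma integrable_primitive_scale p q v : 0 < p -> 0 < q ->
  mu.-integrable setT (fun s => (K p (v - s) * E q s)%:E).
Proof.
move=> p0 q0.
have := integrableD measurableT (integrable_delta v p0 q0)
  (integrable_potential mh M0 hM v p0 q0).
by apply: eq_integrable => // s _; rewrite primitive_scaleK.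
Qed.

Lemma primitive_scale_semigroup p q v : 0 < p -> 0 < q ->
  (\int[mu]_s (K p (v - s) * E q s)%:E = (E (p + q) v)%:E)%E.
Proof.
move=> p0 q0; under eq_integral do rewrite primitive_scaleK.
rewrite integralD//; last 2 first.
- exact: integrable_delta.
- exact: (integrable_potential mh M0 hM).
rewrite integralZl//; last exact: integrable_riesz_kernel_conv.
by rewrite riesz_kernel_conv_shift// (potential_semigroup mh M0 hM).
Qed.

Lemma continuous_primitive_scale q v : 0 < q -> A < v < B ->
  {for v, continuous (E q)}.
Proof.
move=> q0 /andP[Av vB].
have cP : {for v, continuous (potential h q)}.
  by apply: (continuous_potential mh hM ch); rewrite ?Av.
apply: (@continuousD _ R^o R^o (fun v => c * K q (v - A)) (potential h q)) => //.
apply: (@continuousM _ R^o (cst c) (fun v => K q (v - A))).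
  exact: cst_continuous.
apply: (@continuous_comp _ _ _ (fun v => v - A) (K q)).
  apply: (@continuousB _ R^o R^o) => //; exact: cst_continuous.
by apply: continuous_riesz_kernel; rewrite subr_gt0.
Qed.

Lemma integrable_primitive_scale_itv q v : 0 < q ->
  mu.-integrable `[A, v] (fun s => (E q s)%:E).
Proof.
move=> q0.
have : mu.-integrable `[A, v] (fun s => (K 1 (v + 1 - s) * E q s)%:E).
  by apply: (integrableS _ _ _ (integrable_primitive_scale (v + 1) ltr01 q0)).
apply: eq_integrable => // s; rewrite inE/= in_itv/= => /andP[_ sv].
by rewrite riesz_kernel1 ifT ?mul1r//; lra.
Qed.

(** The semigroup law for [p = 1], since [K 1] is an indicator function. *)
Lemma primitive_scale_primitive q v : 0 < q ->
  E (1 + q) v = \int[mu]_(s in `[A, v]) E q s.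
Proof.
move=> q0; rewrite /Rintegral.
suff -> : (\int[mu]_(s in `[A, v]) (E q s)%:E = (E (1 + q) v)%:E)%E by [].
transitivity (\int[mu]_s (K 1 (v - s) * E q s)%:E)%E; last first.
  exact: primitive_scale_semigroup.
rewrite -[LHS]integral_itv_bndo_bndc; last first.
  have := measurable_int _ (integrable_primitive_scale_itv v q0).
  apply: measurable_funS => // s /=.
  by rewrite !in_itv/= => /andP[-> /ltW].
rewrite integral_mkcond; apply: eq_integral => s _.
rewrite patchE riesz_kernel1; case: ifPn; rewrite ?inE ?notin_setE/= in_itv/=.
  by move=> /andP[_ sv]; rewrite subr_gt0 sv mul1r.
have [As|sA _] := leP A s; last by rewrite primitive_scale_le0 ?mulr0// ltW.
move=> /negP; rewrite -leNgt => vs; rewrite ifF ?mul0r//.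
by apply/negbTE; rewrite -leNgt; lra.
Qed.

(** An interior point is a point of continuity of the integrand [E q], even for
    [q < 1], when [E q] is unbounded near [A]. *)
Lemma derive_primitive_scale q v : 0 < q -> A < v < B ->
  derivable (E (1 + q)) v 1 /\ (E (1 + q))^`()%classic v = E q v.
Proof.
move=> q0 /andP[Av vB].
have -> : E (1 + q) = (fun v => \int[mu]_(s in `[A, v]) E q s).
  by apply/funext => t; exact: primitive_scale_primitive.
apply: (@continuous_FTC1_closed _ (E q) A v B) => //.
  exact: integrable_primitive_scale_itv.
by apply: continuous_primitive_scale; rewrite ?Av.
Qed.

Lemma primitive_scale1 v : A < v ->
  E 1 v = c + \int[mu]_(u in `[A, v]) h u.
Proof.
move=> Av; rewrite /primitive_scale riesz_kernel1 subr_gt0 Av mulr1; congr (_ + _).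
rewrite /potential /Rintegral; congr fine.
rewrite -[RHS]integral_itv_bndo_bndc; last first.
  apply/measurable_EFinP; exact: (measurable_funTS mh).
rewrite [RHS]integral_mkcond; apply: eq_integral => s _.
rewrite patchE riesz_kernel1.
case: (boolP (s \in `[A, v[%classic)); rewrite ?inE ?notin_setE/= in_itv/=.
  by move=> /andP[_ sv]; rewrite subr_gt0 sv mul1r.
have [As|sA _] := leP A s; last first.
  have := hM s; rewrite riesz_kernel_le0; last by rewrite subr_le0 ltW.
  rewrite mulr0 normr_le0.
  by move=> /eqP ->; rewrite mulr0.
move=> /negP; rewrite -leNgt => vs; rewrite ifF ?mul0r//.
by apply/negbTE; rewrite -leNgt; lra.
Qed.

End primitive_scale.

(** * Transport by a power function *)

Section power_transport.
Context {R : realType}.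
Notation mu := (@lebesgue_measure R).

Lemma integrable_itv_oo (P Q : R) (f : R -> R) :
  mu.-integrable `]P, Q[ (EFin \o f) -> mu.-integrable `[P, Q] (EFin \o f).
Proof.
move=> /integrableP[mf fi]; apply/integrableP; split.
  apply/measurable_EFinP; apply: (@measurable_fun_itv_cc _ _ _ false true).
  exact/measurable_EFinP.
rewrite (@integral_itv_bndoo _ _ _ _ true false)//.
exact: measurableT_comp.
Qed.

(** [g] is only known inside ]P, Q[: at the end points the integrands of the
    theorem take arbitrary values, which a null set hides. *)
Lemma integral_power_transport (P Q rho k : R) (G g : R -> R) :
  0 < P -> P < Q -> 0 < rho ->
  mu.-integrable setT (EFin \o G) ->
  (forall u, ~~ (P `^ rho < u < Q `^ rho) -> G u = 0) ->
  (forall t, P < t < Q -> g t = k * (rho * t `^ (rho - 1) * G (t `^ rho))) ->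
  mu.-integrable `[P, Q] (EFin \o g) /\
  (\int[mu]_(t in `[P, Q]) (g t)%:E = k%:E * \int[mu]_u (G u)%:E)%E.
Proof.
move=> P0 PQ rho0 iG G0 gG.
have mG : measurable_fun setT G.
  by have /integrableP[/measurable_EFinP] := iG.
pose w t := rho * t `^ (rho - 1) * G (t `^ rho).
have mw : measurable_fun setT w.
  apply: measurable_funM; first exact: measurable_funM.
  by apply: (measurableT_comp mG).
have restrictG f : (forall u, G u = 0 -> f u = 0) ->
    (\int[mu]_(u in `[(P `^ rho)%R, (Q `^ rho)%R]) (f u)%:E = \int[mu]_u (f u)%:E)%E.
  move=> fG; rewrite integral_mkcond; apply: eq_integral => u _.
  rewrite patchE; case: ifPn => // /negP uPQ; rewrite fG// G0//.
  apply/negP => /andP[/ltW Pu /ltW uQ]; apply: uPQ.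
  by rewrite inE/= in_itv/= Pu uQ.
have iw : mu.-integrable `[P, Q] (EFin \o w).
  apply/integrableP; split.
    by apply/measurable_EFinP; exact: (measurable_funTS mw).
  have nG : measurable_fun setT (fun u => `|G u|) by exact: measurableT_comp.
  have := integral_substitution_powR P0 rho0 (ltW PQ) nG.
  rewrite restrictG; last by move=> u ->; rewrite normr0.
  move=> H; have /integrableP[_] := iG.
  under eq_integral do rewrite /=.
  rewrite H; congr (_ < _)%E; apply: eq_integral => t _.
  by rewrite /w /= !normrM (ger0_norm (powR_ge0 _ _)) gtr0_norm.
have PQoc : `]P, Q[ `<=` `[P, Q].
  by move=> t /=; rewrite !in_itv/= => /andP[/ltW -> /ltW ->].
have {}iw : mu.-integrable `]P, Q[ (EFin \o w) by apply: (integrableS _ _ _ iw).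
have ig : mu.-integrable `]P, Q[ (EFin \o g).
  have : mu.-integrable `]P, Q[ (fun t => k%:E * (w t)%:E)%E by exact: integrableZl.
  apply: eq_integrable => // t; rewrite inE/= in_itv/= => tPQ.
  by rewrite /= gG.
split; first exact: integrable_itv_oo.
have mgo : measurable_fun `]P, Q[ (EFin \o g) by exact: measurable_int ig.
have -> : (\int[mu]_(t in `[P, Q]) (g t)%:E = \int[mu]_(t in `]P, Q[) (g t)%:E)%E.
  by rewrite (@integral_itv_bndoo _ _ _ _ true false).
transitivity (\int[mu]_(t in `]P, Q[) (k%:E * (w t)%:E))%E.
  by apply: eq_integral => t; rewrite inE/= in_itv/= => tPQ; rewrite gG.
rewrite integralZl//; congr (_ * _)%E.
rewrite -restrictG// (integral_substitution_powR P0 rho0 (ltW PQ) mG).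
rewrite [RHS](@integral_itv_bndoo _ _ _ _ true false)//.
by apply/measurable_EFinP; exact: (measurable_funTS mw).
Qed.

End power_transport.

Section katugampola_of_primitive_scale.
Context {R : realType}.
Notation mu := (@lebesgue_measure R).
Notation K := (@riesz_kernel R).
Context (A c M : R) (h : R -> R).
Hypotheses (mh : measurable_fun setT h) (M0 : 0 <= M).
Hypothesis hM : forall u, `|h u| <= M * K 1 (u - A).
Notation E := (primitive_scale A c h).
Context (rho gamma q k : R) (y : R -> R).
Hypotheses (rho0 : 0 < rho) (gamma0 : 0 < gamma) (q0 : 0 < q).

(* [k * Gamma gamma / rho] is the constant that [integral_power_transport] needs;
   the normalization of the fractional integral turns it into a power of [rho]. *)
Let prefactor (X : R) :
  rho `^ (1 - gamma) / Gamma gamma * (k * Gamma gamma / rho * X) =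
  rho `^ (- gamma) * k * X.
Proof.
have -> : rho `^ (1 - gamma) = rho * rho `^ (- gamma).
  by rewrite (@powRD _ rho 1) ?(gt_eqF rho0) ?implybT// powRr1// ltW.
by field; rewrite !gt_eqF ?Gamma_gt0.
Qed.

(** In the variable [u = tau ^ rho] the integral is a convolution with
    [K gamma], and the semigroup law applies. *)
Lemma left_integral_primitive_scale (a t : R) : 0 < a -> A = a `^ rho -> a < t ->
  (forall tau, a < tau < t -> y tau = k * E q (tau `^ rho)) ->
  mu.-integrable `[a, t] (EFin \o left_integrand gamma rho y t) /\
  left_integral a gamma rho y t = rho `^ (- gamma) * k * E (gamma + q) (t `^ rho).
Proof.
move=> a0 Aa at_ yE.
pose G u := K gamma (t `^ rho - u) * E q u.
have iG : mu.-integrable setT (EFin \o G).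
  exact: (integrable_primitive_scale c mh M0 hM).
have [||ig Ig] := integral_power_transport (k := k * Gamma gamma / rho)
    (g := left_integrand gamma rho y t) a0 at_ rho0 iG.
- move=> u; rewrite negb_and -!leNgt => /orP[ua|tu]; rewrite /G.
    by rewrite (primitive_scale_le0 c hM) ?Aa// mulr0.
  by rewrite riesz_kernel_le0 ?mul0r// subr_le0.
- move=> tau /andP[a_tau tau_t]; rewrite /left_integrand /G yE ?a_tau//.
  rewrite riesz_kernelE; last first.
    by rewrite subr_gt0; apply: gt0_ltr_powR => //; rewrite nnegrE; lra.
  by field; rewrite !gt_eqF ?Gamma_gt0.
split=> //; rewrite /left_integral /Rintegral Ig.
rewrite (primitive_scale_semigroup c mh M0 hM)//= ; exact: prefactor.
Qed.

(** Same as on the left, with the decreasing variable [u = - tau ^ rho], for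
    which the base point [b] becomes the left end [A]. *)
Lemma right_integral_primitive_scale (b t : R) : 0 < t -> A = - b `^ rho -> t < b ->
  (forall tau, t < tau < b -> y tau = k * E q (- tau `^ rho)) ->
  mu.-integrable `[t, b] (EFin \o right_integrand gamma rho y t) /\
  right_integral b gamma rho y t =
    rho `^ (- gamma) * k * E (gamma + q) (- t `^ rho).
Proof.
move=> t0 Ab tb yE.
pose H u := K gamma (- t `^ rho - u) * E q u.
pose G u := H (- u).
have iH : mu.-integrable setT (EFin \o H).
  exact: (integrable_primitive_scale c mh M0 hM).
have mH : measurable_fun setT H by have /integrableP[/measurable_EFinP] := iH.
have iG : mu.-integrable setT (EFin \o G).
  apply/integrableP; split.
    by apply/measurable_EFinP; apply: (measurableT_comp mH); exact: measurable_funN.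
  have nH : measurable_fun setT (fun u => `|H u|) by exact: measurableT_comp.
  have /integrableP[_ iH_lty] := iH.
  rewrite -[X in (X < _)%E]/(\int[mu]_u (`|H (- u)|)%:E)%E.
  by rewrite -(change_of_variables_opp nH).
have [||ig Ig] := integral_power_transport (k := k * Gamma gamma / rho)
    (g := right_integrand gamma rho y t) t0 tb rho0 iG.
- move=> u; rewrite negb_and -!leNgt => /orP[ut|bu]; rewrite /G /H.
    by rewrite riesz_kernel_le0 ?mul0r// opprK addrC subr_le0.
  by rewrite (primitive_scale_le0 c hM) ?Ab ?lerN2// mulr0.
- move=> tau /andP[t_tau tau_b]; rewrite /right_integrand /G /H yE ?t_tau//.
  rewrite opprK (addrC (- _)) riesz_kernelE; last first.
    by rewrite subr_gt0; apply: gt0_ltr_powR => //; rewrite nnegrE; lra.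
  by field; rewrite !gt_eqF ?Gamma_gt0.
split=> //; rewrite /right_integral /Rintegral Ig.
rewrite /G -(change_of_variables_opp mH).
rewrite (primitive_scale_semigroup c mh M0 hM)//= ; exact: prefactor.
Qed.

End katugampola_of_primitive_scale.

Section iterated_operator.
Context {R : realType}.
Context (A B : R) (E : R -> R -> R).
Hypothesis dE : forall q v : R, 0 < q -> A < v < B ->
  derivable (E (1 + q)) v 1 /\ (E (1 + q))^`()%classic v = E q v.
(* Both sides at once: [phi s] is [s ^ rho] or [- s ^ rho], and [m s] the factor
   [s ^ (1 - rho)] or [- s ^ (1 - rho)]. *)
Context (P Q rho alpha : R) (phi dphi m : R -> R).
Hypothesis rho0 : 0 < rho.
Hypothesis phiPQ : forall s, P < s < Q -> A < phi s < B.
Hypothesis dphiE : forall s, P < s < Q -> is_derive s 1 phi (dphi s).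
Hypothesis mdphi : forall s, P < s < Q -> m s * dphi s = rho.
Context (n : nat) (F : R -> R).
Hypothesis halpha : n%:R - 1 < alpha.
Hypothesis FE : forall s, P < s < Q ->
  F s = rho `^ (- alpha) * E (alpha + 1) (phi s).

Let op (f : R -> R) : R -> R := fun t => m t * derive1 f t.

Let derivative_step (q r : R) (f : R -> R) s : 0 < q -> P < s < Q ->
  (forall s, P < s < Q -> f s = r * E (1 + q) (phi s)) ->
  derivable f s 1 /\ op f s = rho * r * E q (phi s).
Proof.
move=> q0 sPQ fE.
have [dEs EsE] := dE q0 (phiPQ sPQ).
have Edrv : is_derive (phi s) 1 (E (1 + q)) (E q (phi s)).
  by rewrite -EsE derive1E; exact/derivableP.
have phis := dphiE sPQ.
have comp : is_derive s 1 (E (1 + q) \o phi) (dphi s * E q (phi s)).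
  by rewrite mulrC; exact: is_derive1_comp.
have rcomp : is_derive s 1 (fun s => r * (E (1 + q) \o phi) s)
    (r * (dphi s * E q (phi s))).
  exact: (is_deriveZ r).
have fs : is_derive s 1 f (r * (dphi s * E q (phi s))).
  apply: near_eq_is_derive rcomp.
  have /near_in_itvoo : s \in `]P, Q[ by rewrite in_itv/=.
  by apply: filterS => t; rewrite in_itv/= => /fE ->.
split; first exact: ex_derive.
rewrite /op derive1E derive_val mulrCA (mulrA (m s)) mdphi//.
by rewrite mulrA (mulrC r).
Qed.

(** By [mdphi] and the chain rule, [op] acts on functions of [phi s] as
    [rho * d / dv], and each derivative in [v] lowers the order by one. *)
Lemma iter_operatorE k s : (k <= n)%N -> P < s < Q ->
  iter k op F s = rho `^ (k%:R - alpha) * E (alpha + 1 - k%:R) (phi s).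
Proof.
elim: k s => [|k IHk] s kn sPQ; first by rewrite /= FE// sub0r subr0.
have q0 : 0 < alpha - k%:R.
  by rewrite subr_gt0 (le_lt_trans _ halpha)// lerBrDr natr1 ler_nat.
have [|_] := @derivative_step _ (rho `^ (k%:R - alpha)) (iter k op F) s q0 sPQ.
  move=> t tPQ; rewrite IHk ?(ltnW kn)//; congr (_ * E _ _); ring.
rewrite /= => ->; congr (_ * E _ _); last by rewrite -natr1; ring.
rewrite -natr1 (_ : k%:R + 1 - alpha = 1 + (k%:R - alpha)); last by ring.
by rewrite (@powRD _ rho 1) ?(gt_eqF rho0) ?implybT// powRr1// ltW.
Qed.

Lemma derivable_iter_operator k s : (k < n)%N -> P < s < Q ->
  derivable (iter k op F) s 1.
Proof.
move=> kn sPQ.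
have q0 : 0 < alpha - k%:R.
  by rewrite subr_gt0 (le_lt_trans _ halpha)// lerBrDr natr1 ler_nat.
have [|//] := @derivative_step _ (rho `^ (k%:R - alpha)) (iter k op F) s q0 sPQ.
move=> t tPQ; rewrite iter_operatorE ?(ltnW kn)//; congr (_ * E _ _); ring.
Qed.

End iterated_operator.

(** * Functions of class C^1 as primitives *)

Section continuously_differentiable.
Context {R : realType}.
Notation mu := (@lebesgue_measure R).
Context (a b : R) (x dx : R -> R).
Hypotheses (ab : a < b) (xdx : is_derivative_on a b x dx).
Hypothesis cdx : {within `[a, b], continuous dx}.

(* Caratheodory's slope: continuous at [t], and [x] is recovered from it by
   multiplication, at the end points as well. *)
Let slope t s := if s == t then dx t else (x s - x t) / (s - t).

Let slopeE t s : x s - x t = slope t s * (s - t).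
Proof.
rewrite /slope; case: eqVneq => [->|st]; first by rewrite !subrr mulr0.
by rewrite divfK// subr_eq0.
Qed.

Let slope_cvg t : a <= t <= b -> slope t @ within `[a, b] (nbhs t) --> dx t.
Proof.
move=> tab; have /cvgrPdist_lt xt := xdx tab.
apply/cvgrPdist_lt => e e0; have := xt e e0.
rewrite !near_withinE; apply: filterS => s xs sab.
by rewrite /slope; case: eqVneq => [_|st]; [rewrite subrr normr0|exact: xs].
Qed.

Let is_derive_interior t : a < t < b -> is_derive t 1 x (dx t).
Proof.
move=> /andP[at_ tb]; apply/is_derive1_caratheodory; exists (slope t); split.
- by move=> s; exact: slopeE.
- have slope_tt : slope t t = dx t by rewrite /slope eqxx.
  rewrite /prop_for /continuous_at slope_tt.
  have /cvgrPdist_lt st := slope_cvg (t := t) ltac:(by rewrite !ltW).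
  apply/cvgrPdist_lt => e e0; have := st e e0; rewrite near_withinE.
  have : t \in `]a, b[ by rewrite in_itv/= at_.
  move=> /near_in_itvoo; apply: filterS2 => s.
  by rewrite in_itv/= => /andP[as_ sb]; apply; rewrite /= in_itv/= !ltW.
- by rewrite /slope eqxx.
Qed.

Let within_continuous : {within `[a, b], continuous x}.
Proof.
apply/subspace_continuousP => t /=; rewrite in_itv/= => tab.
suff : (fun s => x t + slope t s * (s - t)) @ within `[a, b] (nbhs t) -->
    x t + dx t * (t - t).
  rewrite subrr mulr0 addr0 (_ : (fun s => _) = x)//.
  by apply/funext => s; rewrite -slopeE addrC subrK.
apply: (@cvgD _ R^o); first exact: cvg_cst.
apply: cvgM; first exact: slope_cvg.
apply: (@cvgB _ R^o); last exact: cvg_cst.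
exact: cvg_within.
Qed.

Lemma integral_derivative s t : a <= s -> s <= t -> t <= b ->
  (\int[mu]_(u in `[s, t]) (dx u)%:E = (x t - x s)%:E)%E.
Proof.
move=> as_; rewrite le_eqVlt => /predU1P[<- _|st tb].
  by rewrite set_itv1 integral_set1 subrr.
have stab : `[s, t] `<=` `[a, b].
  by move=> u /=; rewrite !in_itv/= => /andP[su ut]; apply/andP; split; lra.
have cst := continuous_subspaceW stab within_continuous.
have [_ xs xt] := (continuous_within_itvP _ st).1 cst.
rewrite (continuous_FTC2 st (F := x))//.
- exact: continuous_subspaceW cdx.
- split => // u; rewrite in_itv/= => /andP[su ut].
  by have [] := is_derive_interior (t := u) ltac:(apply/andP; split; lra).
- move=> u; rewrite in_itv/= => /andP[su ut].
  have := is_derive_interior (t := u) ltac:(apply/andP; split; lra).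
  by move=> ?; rewrite derive1E derive_val.
Qed.

Lemma continuous_within_bounded (f : R -> R) : {within `[a, b], continuous f} ->
  exists2 M : R, 0 <= M & forall t, a <= t <= b -> `|f t| <= M.
Proof.
move=> cf.
have [c1 _ fc1] := EVT_max (ltW ab) cf.
have [c2 _ fc2] := EVT_min (ltW ab) cf.
exists (`|f c1| + `|f c2|); first by rewrite addr_ge0.
move=> t tab; have {}tab : t \in `[a, b] by rewrite in_itv.
rewrite ler_norml; apply/andP; split.
  rewrite lerNl (le_trans (_ : _ <= - f c2)) ?lerN2 ?fc2//.
  by rewrite (le_trans (ler_norm _))// normrN lerDr.
by rewrite (le_trans (fc1 _ tab))// (le_trans (ler_norm _))// lerDl.
Qed.

End continuously_differentiable.

(** The derivative of [x] with respect to [u = t ^ rho], cut off at the ends of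
    the interval.  Only its integrals are related to [x], which spares the
    one-sided derivatives at the end points. *)
Lemma class_C1_power_density (R : realType) (a b rho : R) (x : R -> R) :
  0 < a -> a < b -> 0 < rho -> class_C 1 a b x ->
  exists (M : R) (h : R -> R), [/\ 0 <= M, measurable_fun setT h,
    forall u, `|h u| <= M,
    forall u : R, ~~ (a `^ rho < u < b `^ rho) -> h u = 0 &
    (forall u : R, a `^ rho < u < b `^ rho -> {for u, continuous h}) /\
    (forall s t : R, a <= s -> s <= t -> t <= b ->
      \int[lebesgue_measure]_(u in `[s `^ rho, t `^ rho]) h u = x t - x s)].
Proof.
move=> a0 ab rho0 [dx xdx cdx]; rewrite /= in cdx.
have rho_neq0 : rho != 0 by rewrite gt_eqF.
set A := a `^ rho; set B := b `^ rho.
have b0 := lt_trans a0 ab.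
have A0 : 0 < A by exact: powR_gt0.
have AB : A < B by apply: gt0_ltr_powR => //; rewrite nnegrE ltW.
pose g u := dx (u `^ rho^-1) * (rho^-1 * u `^ (rho^-1 - 1)).
have root_itv (u : R) : A < u < B -> a < u `^ rho^-1 < b.
  move=> /andP[Au uB]; have irho0 : 0 < rho^-1 by rewrite invr_gt0.
  have powK z : 0 < z -> z = (z `^ rho) `^ rho^-1.
    by move=> z0; rewrite -powRrM divff// powRr1// ltW.
  rewrite [X in X < _ < _](powK a)// [X in _ < _ < X](powK b)// -/A -/B.
  by apply/andP; split; apply: gt0_ltr_powR => //; rewrite ?nnegrE; lra.
have cg (u : R) : A < u < B -> {for u, continuous g}.
  move=> uAB; have u0 : 0 < u by lra.
  apply: (@continuousM _ R^o (fun u => dx (u `^ rho^-1))).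
    apply: (@continuous_comp _ _ _ (@powR R ^~ rho^-1) dx).
      exact: continuous_powR.
    have [+ _ _] := (continuous_within_itvP _ ab).1 cdx.
    by apply; rewrite in_itv/= root_itv.
  apply: (@continuousM _ R^o (cst rho^-1)); first exact: cst_continuous.
  exact: continuous_powR.
have mg : measurable_fun `]A, B[ g.
  apply: open_continuous_measurable_fun; first exact: interval_open.
  by move=> u; rewrite inE/= in_itv/=; exact: cg.
have [M1 M10 dxM1] := continuous_within_bounded ab cdx.
have [M2 M20 powM2] : exists2 M : R, 0 <= M &
    forall u : R, A <= u <= B -> `|rho^-1 * u `^ (rho^-1 - 1)| <= M.
  apply: (continuous_within_bounded AB (f := fun u => rho^-1 * u `^ (rho^-1 - 1))).
  apply/continuous_in_subspaceT => u /[!inE]/= /[!in_itv]/= /andP[Au _].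
  apply: (@continuousM _ R^o (cst rho^-1) (fun u => u `^ (rho^-1 - 1))).
    exact: cst_continuous.
  by apply: continuous_powR; exact: lt_le_trans Au.
pose h := g \_ `]A, B[.
have hg u : A < u < B -> h u = g u.
  by move=> uAB; rewrite /h patchE mem_set//= in_itv.
have h0 u : ~~ (A < u < B) -> h u = 0.
  by move=> uAB; rewrite /h patchE memNset//= in_itv/=; exact/negP.
have mh : measurable_fun setT h by apply/(measurable_restrictT _ _).1.
exists (M1 * M2), h; split=> //.
- exact: mulr_ge0.
- move=> u; have [uAB|uAB] := boolP (A < u < B); last by rewrite h0// normr0 mulr_ge0.
  rewrite hg// normrM ler_pM// ?dxM1 ?powM2//.
    by have /andP[/ltW -> /ltW ->] := root_itv _ uAB.
  by move: uAB => /andP[/ltW -> /ltW ->].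
split.
- move=> u uAB; apply: (@cvg_trans _ (g @ u)).
    apply: near_eq_cvg.
    have /near_in_itvoo : u \in `]A, B[ by rewrite in_itv.
    by apply: filterS => v; rewrite in_itv/= => vAB; rewrite hg.
  by rewrite hg//; exact: cg.
move=> s t as_ st tb.
have s0 : 0 < s by lra.
rewrite /Rintegral (integral_substitution_powR s0 rho0 st mh).
rewrite -[RHS]/(fine (x t - x s)%:E) -(integral_derivative xdx cdx as_ st tb).
congr fine.
have mdx : measurable_fun `]s, t[ dx.
  apply: open_continuous_measurable_fun; first exact: interval_open.
  move=> u; rewrite inE/= in_itv/= => /andP[su ut].
  have [+ _ _] := (continuous_within_itvP _ ab).1 cdx.
  by apply; rewrite in_itv/=; apply/andP; split; lra.
rewrite [LHS](@integral_itv_bndoo _ _ _ _ true false); last first.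
  apply/measurable_EFinP; apply: measurable_funTS; apply: measurable_funM.
    exact: measurable_funM.
  by apply: (measurableT_comp mh).
rewrite [RHS](@integral_itv_bndoo _ _ _ _ true false); last exact/measurable_EFinP.
apply: eq_integral => u; rewrite inE/= in_itv/= => /andP[su ut].
have u0 : 0 < u by lra.
congr EFin; rewrite hg; last first.
  by apply/andP; split; apply: gt0_ltr_powR => //; rewrite ?nnegrE; lra.
rewrite /g -powRrM divff// powRr1 ?(ltW u0)//.
rewrite -powRrM mulrBr divff// mulr1.
rewrite mulrCA -[RHS]mulr1; congr (_ * _).
rewrite mulrACA divff// mul1r -powRD; last by rewrite (gt_eqF u0) implybT.
by rewrite (_ : _ + _ = 0) ?powRr0//; ring.
Qed.

(** * Inversion *)

Section caputo_katugampola_inverse.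
Context {R : realType}.
Notation mu := (@lebesgue_measure R).
Notation K := (@riesz_kernel R).
Context (a b rho alpha : R) (n : nat) (x : R -> R).
Hypotheses (a0 : 0 < a) (rho0 : 0 < rho) (alpha0 : 0 < alpha).
Hypotheses (n_lt : n%:R - 1 < alpha) (lt_n : alpha < n%:R).
Context (M : R) (h : R -> R).
Hypotheses (M0 : 0 <= M) (mh : measurable_fun setT h).
Hypothesis hM : forall u, `|h u| <= M.
Hypothesis h0 : forall u : R, ~~ (a `^ rho < u < b `^ rho) -> h u = 0.
Hypothesis ch : forall u : R, a `^ rho < u < b `^ rho -> {for u, continuous h}.
Hypothesis hx : forall s t : R, a <= s -> s <= t -> t <= b ->
  \int[mu]_(u in `[s `^ rho, t `^ rho]) h u = x t - x s.

Let gamma0 : 0 < n%:R - alpha. Proof. by rewrite subr_gt0. Qed.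
Let beta0 : 0 < alpha + 1 - n%:R. Proof. by move: n_lt; lra. Qed.

Let pow_lt (s t : R) : 0 < s -> s < t -> s `^ rho < t `^ rho.
Proof.
by move=> s0 st; apply: gt0_ltr_powR => //; rewrite nnegrE ltW// (lt_trans s0).
Qed.

Let powV (t : R) : 0 < t -> t `^ (1 - rho) * (rho * t `^ (rho - 1)) = rho.
Proof.
move=> t0; rewrite mulrCA -powRD; last by rewrite (gt_eqF t0) implybT.
by rewrite (_ : _ + _ = 0) ?powRr0 ?mulr1//; ring.
Qed.

Let powKN (p : R) : rho `^ (- p) * rho `^ p = 1.
Proof.
rewrite -powRD; last by rewrite (gt_eqF rho0) implybT.
by rewrite addNr powRr0.
Qed.

Lemma left_caputo_left_integral t : a < t <= b ->
  left_caputo_defined n a alpha rho (left_integral a alpha rho x) t /\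
  left_caputo n a alpha rho (left_integral a alpha rho x) t = x t.
Proof.
move=> /andP[at_ tb].
set A := a `^ rho; set B := b `^ rho.
have hMK (u : R) : `|h u| <= M * K 1 (u - A).
  have [uA|Au] := leP u A; last by rewrite riesz_kernel1 subr_gt0 Au mulr1.
  rewrite h0 ?normr0; first exact: mulr_ge0 M0 (riesz_kernel_ge0 _ ltr01).
  by rewrite -/A negb_and -leNgt uA.
pose E := primitive_scale A (x a) h.
have E1 (s : R) : a < s <= b -> E 1 (s `^ rho) = x s.
  move=> /andP[as_ sb]; rewrite /E (primitive_scale1 (x a) mh hMK) ?pow_lt//.
  by rewrite hx ?lexx ?(ltW as_)// addrC subrK.
set F := left_integral a alpha rho x.
have FE (s : R) : a < s < b -> F s = rho `^ (- alpha) * E (alpha + 1) (s `^ rho).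
  move=> /andP[as_ sb].
  have xE (tau : R) : a < tau < s -> x tau = 1 * E 1 (tau `^ rho).
    by move=> /andP[a_tau tau_s]; rewrite mul1r E1// a_tau; lra.
  rewrite /F; have [_ ->] := left_integral_primitive_scale mh M0 hMK rho0 alpha0 ltr01
    a0 (erefl _) as_ xE.
  by rewrite mulr1.
have dE (q v : R) : 0 < q -> A < v < B ->
    derivable (E (1 + q)) v 1 /\ (E (1 + q))^`()%classic v = E q v.
  exact: (derive_primitive_scale (x a) mh M0 hMK ch).
have phiE (s : R) : a < s < b -> A < s `^ rho < B.
  by move=> /andP[as_ sb]; rewrite /A /B !pow_lt// (lt_trans a0).
have dphi (s : R) : a < s < b -> is_derive s 1 (@powR R ^~ rho) (rho * s `^ (rho - 1)).
  by move=> /andP[as_ _]; apply: is_derive1_powR; exact: lt_trans as_.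
have mdphi (s : R) : a < s < b -> s `^ (1 - rho) * (rho * s `^ (rho - 1)) = rho.
  by move=> /andP[as_ _]; apply: powV; exact: lt_trans as_.
have iterE (s : R) : a < s < t -> iter n (left_op rho) F s =
    rho `^ (n%:R - alpha) * E (alpha + 1 - n%:R) (s `^ rho).
  move=> /andP[as_ st].
  apply: (iter_operatorE dE rho0 phiE dphi mdphi n_lt FE (leqnn n)).
  by rewrite as_; lra.
have [iy Iy] := left_integral_primitive_scale mh M0 hMK rho0 gamma0
  beta0 a0 (erefl _) at_ iterE.
split; last first.
  rewrite /left_caputo Iy powKN mul1r.
  rewrite (_ : _ + _ = 1); last by ring.
  by apply: E1; rewrite at_.
split=> // k s kn /andP[as_ st].
apply: (derivable_iter_operator dE rho0 phiE dphi mdphi n_lt FE kn).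
by rewrite as_; lra.
Qed.

(** The reflection [u -> - u] carries [h] to [g], up to the sign that comes from
    differentiating [- u]. *)
Lemma right_caputo_right_integral t : a <= t < b ->
  right_caputo_defined n b alpha rho (right_integral b alpha rho x) t /\
  right_caputo n b alpha rho (right_integral b alpha rho x) t = x t.
Proof.
move=> /andP[at_ tb].
set A := - b `^ rho; set B := - a `^ rho.
pose g u := - h (- u).
have mg : measurable_fun setT g.
  by apply: measurable_funN; apply: (measurableT_comp mh); exact: measurable_funN.
have gM (u : R) : `|g u| <= M * K 1 (u - A).
  rewrite normrN; have [uA|Au] := leP u A; last by rewrite riesz_kernel1 subr_gt0 Au mulr1.
  rewrite h0 ?normr0; first exact: mulr_ge0 M0 (riesz_kernel_ge0 _ ltr01).
  by rewrite negb_and -!leNgt lerNr uA orbT.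
have cg (u : R) : A < u < B -> {for u, continuous g}.
  move=> uAB; apply: (@continuousN _ R^o R^o (fun u => h (- u))).
  apply: (@continuous_comp _ _ _ -%R h); first exact: (@continuousN _ R^o R^o id).
  by apply: ch; rewrite ltrNr andbC ltrNl.
pose E := primitive_scale A (x b) g.
have E1 (s : R) : a <= s < b -> E 1 (- s `^ rho) = x s.
  move=> /andP[as_ sb]; have s0 : 0 < s by exact: lt_le_trans as_.
  rewrite /E (primitive_scale1 (x b) mg gM) ?ltrN2 ?pow_lt//.
  have sb' : s `^ rho < b `^ rho by exact: pow_lt.
  have ih : mu.-integrable `[s `^ rho, b `^ rho] (EFin \o h).
    apply: measurable_bounded_integrable => //.
    - by rewrite /= lebesgue_measure_itv/= lte_fin sb' -EFinB ltry.
    - exact: (measurable_funTS mh).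
    - exists M; split; first by rewrite num_real.
      by move=> z Mz u _; exact: le_trans (hM u) (ltW Mz).
  suff -> : \int[mu]_(u in `[A, - s `^ rho]) g u =
      - \int[mu]_(u in `[s `^ rho, b `^ rho]) h u.
    by rewrite hx ?(ltW sb) ?lexx// opprB addrC subrK.
  rewrite -[RHS]mulN1r -RintegralZl// /Rintegral; congr fine.
  rewrite integral_mkcond [RHS]integral_mkcond.
  pose f := (fun u => -1 * h u) \_ `[s `^ rho, b `^ rho].
  have mf : measurable_fun setT f.
    apply/(measurable_restrictT _ _).1 => //.
    apply: measurable_funM => //; exact: (measurable_funTS mh).
  transitivity (\int[mu]_u (f u)%:E)%E; last first.
    by apply: eq_integral => u _; rewrite /f !patchE; case: ifP.
  rewrite (change_of_variables_opp mf); apply: eq_integral => u _.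
  rewrite /f !patchE /g mulN1r.
  rewrite (_ : (- u \in `[s `^ rho, b `^ rho]%classic) =
    (u \in `[A, - s `^ rho]%classic)); first by case: ifP.
  by apply/idP/idP; rewrite !inE/= !in_itv/= lerNr lerNl andbC.
set F := right_integral b alpha rho x.
have FE (s : R) : a < s < b -> F s = rho `^ (- alpha) * E (alpha + 1) (- s `^ rho).
  move=> /andP[as_ sb]; have s0 : 0 < s by exact: lt_trans as_.
  have xE (tau : R) : s < tau < b -> x tau = 1 * E 1 (- tau `^ rho).
    by move=> /andP[s_tau tau_b]; rewrite mul1r E1// tau_b andbT; lra.
  rewrite /F; have [_ ->] := right_integral_primitive_scale mg M0 gM rho0 alpha0 ltr01
    s0 (erefl _) sb xE.
  by rewrite mulr1.
have dE (q v : R) : 0 < q -> A < v < B ->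
    derivable (E (1 + q)) v 1 /\ (E (1 + q))^`()%classic v = E q v.
  exact: (derive_primitive_scale (x b) mg M0 gM cg).
have phiE (s : R) : a < s < b -> A < - s `^ rho < B.
  move=> /andP[as_ sb]; rewrite !ltrN2.
  by rewrite !pow_lt// (lt_trans a0).
have dphi (s : R) : a < s < b ->
    is_derive s 1 (fun s => - s `^ rho) (- (rho * s `^ (rho - 1))).
  move=> /andP[as_ _]; apply: is_deriveN.
  by apply: is_derive1_powR; exact: lt_trans as_.
have mdphi (s : R) : a < s < b ->
    - (s `^ (1 - rho)) * - (rho * s `^ (rho - 1)) = rho.
  by move=> /andP[as_ _]; rewrite mulrNN; apply: powV; exact: lt_trans as_.
have iterE (s : R) : t < s < b -> iter n (right_op rho) F s =
    rho `^ (n%:R - alpha) * E (alpha + 1 - n%:R) (- s `^ rho).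
  move=> /andP[ts sb].
  apply: (iter_operatorE dE rho0 phiE dphi mdphi n_lt FE (leqnn n)).
  by rewrite sb andbT; lra.
have t0 : 0 < t by exact: lt_le_trans at_.
have [iy Iy] := right_integral_primitive_scale mg M0 gM rho0 gamma0
  beta0 t0 (erefl _) tb iterE.
split; last first.
  rewrite /right_caputo Iy powKN mul1r.
  rewrite (_ : _ + _ = 1); last by ring.
  by apply: E1; rewrite at_.
split=> // k s kn /andP[ts sb].
apply: (derivable_iter_operator dE rho0 phiE dphi mdphi n_lt FE kn).
by rewrite sb andbT; lra.
Qed.

End caputo_katugampola_inverse.

Unset Implicit Arguments.

Theorem theorem5 (R : realType) (a b rho alpha : R) (n : nat)
    (ha : 0 < a) (hab : a < b) (hrho : 0 < rho) (halpha : 0 < alpha)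
    (hn : n%:R - 1 < alpha < n%:R)
    (x : R -> R) (hx : class_C 1 a b x) :
  (forall t : R, a < t <= b ->
     left_caputo_defined n a alpha rho (left_integral a alpha rho x) t /\
     left_caputo n a alpha rho (left_integral a alpha rho x) t = x t) /\
  (forall t : R, a <= t < b ->
     right_caputo_defined n b alpha rho (right_integral b alpha rho x) t /\
     right_caputo n b alpha rho (right_integral b alpha rho x) t = x t).
Proof.
have /andP[n_lt lt_n] := hn.
have [M [h [M0 mh hM h0 [ch xh]]]] := class_C1_power_density ha hab hrho hx.
split=> t tab.
  exact: (left_caputo_left_integral ha hrho halpha n_lt lt_n M0 mh hM h0 ch xh).
exact: (right_caputo_right_integral ha hrho halpha n_lt lt_n M0 mh hM h0 ch xh).
Qed.
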